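(* Let $\Gamma$ be a finitely generated group, $(\rho_k)$ a diverging sequence of representations $\Gamma\to\mathrm{Isom}\,\mathbf H^N$ with limit action $\rho_\infty$ on the minimal tree $T$ (along a non-principal ultrafilter $\omega$), and let $\ell(k)$, $\mathcal I_k$, $R_k:=\mathcal I_k\circ(\nu_{t_k}\circ\rho_k)\circ\mathcal I_k^{-1}$ and $R_\infty:=\mu_1\circ\rho_\infty$ be as constructed in the context (with $t_k=r_k^{-1}$). Let $J\subset\mathbf N$ be a subset such that $\lim_{k\in J}\ell(k)=+\infty$. Then: - the subsequence $(R_k)_{k\in J}$ converges to $R_\infty$ in the space of representations $\Gamma\to\mathrm{Isom}\,\mathbf H^\infty$, i.e. $R_k(\gamma)z\to R_\infty(\gamma)z$ for all $\gamma\in\Gamma$, $z\in\mathbf H^\infty$; - if moreover $\Gamma=\mathbf F_r$ and $R_\infty$ is Schottky, then $\lim_{k\in J}\mathrm{Hdim}\,\Lambda_{R_k}=\mathrm{Hdim}\,\Lambda_{R_\infty}$.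
   Context: Limit tree. Let $S$ be a finite symmetric generating set of $\Gamma$ and $d$ the metric of $\mathbf H^N$. Put $r_k:=\inf_{x}\max_{s\in S}d(x,\rho_k(s)x)$; diverging means $r_k\to+\infty$ (only the $k$ with $r_k>1$ are considered). Choose $o_k$ with $\max_{s\in S}d(o_k,\rho_k(s)o_k)\le r_k+1$; $X_k=(\mathbf H^N,d_{X_k}=r_k^{-1}d,o_k)$. The asymptotic cone $(X_\omega,d_\omega,o_\omega)$ is the set of sequences $(x_k)$ with $\omega\text{-}\lim r_k^{-1}d(x_k,o_k)<\infty$ modulo $\omega\text{-}\lim r_k^{-1}d(x_k,y_k)=0$, with $d_\omega=\omega\text{-}\lim r_k^{-1}d$ and $o_\omega=[(o_k)]$; $\Gamma$ acts on it by $[(x_k)]\mapsto[(\rho_k(\gamma)x_k)]$. It is a real tree containing a unique minimal closed convex invariant subtree $T$, separable and containing $o_\omega$; write $d_T=d_\omega|_T$, and $\rho_\infty$ for the action on $T$. Embeddings. $\mathbf H^\infty$ is the separable infinite-dimensional hyperbolic space. For $0<t<1$, $f_t:\mathbf H^N\to\mathbf H^\infty$ is a fixed continuous embedding with total image (not in a proper closed hyperbolic subspace) and $\cosh d(f_t(x),f_t(y))=\beta^t(x,y):=(\cosh d(x,y))^t$; $\nu_t:\mathrm{Isom}\,\mathbf H^N\to\mathrm{Isom}\,\mathbf H^\infty$ satisfies $f_t\circ g=\nu_t(g)\circ f_t$. $F_1:T\to\mathbf H^\infty$ is a fixed continuous embedding with total image and $\cosh d(F_1(x),F_1(y))=\beta_1(x,y):=e^{d_T(x,y)}$;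 $\mu_1:\mathrm{Isom}\,T\to\mathrm{Isom}\,\mathbf H^\infty$ satisfies $F_1\circ g=\mu_1(g)\circ F_1$. Let $t_k=r_k^{-1}$. Construction of $\ell(k)$ and $\mathcal I_k$. Fix an increasing sequence of finite sets $E_l=\{x^0,\dots,x^l\}\subset T$ with $x^0=o_\omega$, $\#E_l=l+1$, and $E=\bigcup_lE_l$ dense in $T$; an increasing sequence of finite sets $\Gamma_l\subset\Gamma$ with $\Gamma_0=\{e\}$ and $\bigcup_l\Gamma_l=\Gamma$; and a decreasing sequence $\epsilon_l>0$ tending to $0$. Let $\Gamma_l\cdot E_l=\{\rho_\infty(\gamma)x:\gamma\in\Gamma_l,x\in E_l\}$. For $\epsilon>0$ and a finite $K\subset T$, let $\eta(\epsilon,K)>0$ be a fixed number with the following property: for every metric space $X_2$, every embedding $\phi:K\hookrightarrow X_2$, and every kernel of hyperbolic type $\beta_2$ on $X_2$ with associated map $f_2:X_2\to\mathbf H^\infty$ ($\cosh d(f_2(x),f_2(y))=\beta_2(x,y)$), if $|\beta_2(\phi(x),\phi(y))-\beta_1(x,y)|\le\eta(\epsilon,K)$ for all $x,y\in K$, then there is an isometry $\mathcal F$ of $\mathbf H^\infty$ with $d(\mathcal F(F_1(x)),f_2(\phi(x)))\le\epsilon$ for all $x\in K$. $I(l,\epsilon)$ is the set of $k\in\mathbf N$ for which there are a finite subset $K_{k,l,\epsilon}\subset X_k$ and a relation $\mathcal R_{k,l,\epsilon}\subset E_l\times K_{k,l,\epsilon}$, projecting surjectively on both factors, such that for all $x,x'\in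 E_l$, all $\gamma,\gamma'\in\Gamma_l$ and all $y,y'\in K_{k,l,\epsilon}$ related to $x,x'$ respectively: $|d_T(\gamma x,\gamma'x')-d_{X_k}(\gamma y,\gamma'y')|\le\epsilon$ and $|\beta_1(\gamma x,\gamma'x')-\beta^{t_k}(\gamma y,\gamma'y')|\le\eta(\epsilon,\Gamma_l\cdot E_l)$, where $\gamma$ acts through $\rho_\infty$ on $T$ and $\rho_k$ on $X_k$. For $k\in I(l,\epsilon_l)$ fix such a set $K_{k,l}$ and a choice of points $x^i_{k,l}\in K_{k,l}$ related to $x^i$, $0\le i\le l$. Put $\ell(k):=\max\{l:k\in I(l,\epsilon_l)\}$ (which is finite). $\mathcal I_k$ is a fixed isometry of $\mathbf H^\infty$ such that for all $0\le l\le\ell(k)$ and $\gamma\in\Gamma_{\ell(k)}$, $$d\big(\mathcal I_k\circ f_{t_k}(\rho_k(\gamma)x^l_{k,\ell(k)}),\,F_1(\rho_\infty(\gamma)x^l)\big)\le\epsilon_{\ell(k)}.$$ Kernels. A kernel of hyperbolic type on a set $X$ is a symmetric non-negative function $\beta:X\times X\to\mathbf R$, equal to $1$ on the diagonal, with $\sum_{i,j=1}^nc_ic_j\beta(x_i,x_j)\le\big(\sum_{k=1}^nc_k\beta(x_0,x_k)\big)^2$ for all $n$, $x_0,\dots,x_n\in X$ and $c_i\in\mathbf R$. Schottky and limit sets. A representation $R:\mathbf F_r\to\mathrm{Isom}\,\mathbf H^\infty$ is Schottky if, for some $K\ge1$ and a base point $o$, the orbit map $g\mapsto R(g)o$ satisfies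 $\frac1K|g^{-1}h|-K\le d(R(g)o,R(h)o)\le K|g^{-1}h|+K$, $|\cdot|$ being word length. $\Lambda_R\subset\partial\mathbf H^\infty$ is the set of accumulation points of the orbit of $o$, and $\mathrm{Hdim}$ is the Hausdorff dimension for the visual metric $d_o(\xi,\zeta)=e^{-\langle\xi,\zeta\rangle_o}$, $\langle\cdot,\cdot\rangle_o$ being the Gromov product. *)

(* Defs.v *)
From HB Require Import structures.
From mathcomp Require Import all_boot all_order all_algebra.
From mathcomp Require Import all_classical all_reals all_analysis.
From mathcomp Require Import generic_quotient.
From mathcomp Require Import ring lra.

Set Implicit Arguments.
Unset Strict Implicit.
Unset Printing Implicit Defensive.

Import Order.TTheory GRing.Theory Num.Theory.
Import numFieldNormedType.Exports.

Local Open Scope classical_set_scope.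
Local Open Scope ring_scope.
Local Open Scope quotient_scope.

Section hyperbolic_functions.
Variable R : realType.
Implicit Types u v : R.

Definition cosh u : R := (expR u + expR (- u)) / 2.

Definition acosh u : R := ln (u + Num.sqrt (u ^+ 2 - 1)).

Lemma acosh_arg_ge1 u : 1 <= u -> 1 <= u + Num.sqrt (u ^+ 2 - 1).
Proof. by move=> u1; rewrite -[leLHS]addr0 lerD// sqrtr_ge0. Qed.

Lemma acosh_ge0 u : 1 <= u -> 0 <= acosh u.
Proof. by move=> u1; rewrite ln_ge0// acosh_arg_ge1. Qed.

Lemma expR_acosh u : 1 <= u -> expR (acosh u) = u + Num.sqrt (u ^+ 2 - 1).
Proof.
move=> u1; rewrite lnK// posrE.
by rewrite (lt_le_trans ltr01)// acosh_arg_ge1.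
Qed.

Lemma sqrt_sqrB1 u : 1 <= u -> Num.sqrt (u ^+ 2 - 1) ^+ 2 = u ^+ 2 - 1.
Proof. by move=> u1; rewrite sqr_sqrtr// subr_ge0 exprn_ege1. Qed.

Lemma expRN_acosh u : 1 <= u -> expR (- acosh u) = u - Num.sqrt (u ^+ 2 - 1).
Proof.
move=> u1; rewrite expRN expR_acosh//.
have w1 := acosh_arg_ge1 u1.
have w0 : u + Num.sqrt (u ^+ 2 - 1) != 0.
  by rewrite gt_eqF// (lt_le_trans ltr01).
apply: (mulfI w0); rewrite divff//.
by have := sqrt_sqrB1 u1; nra.
Qed.

Lemma acoshK u : 1 <= u -> cosh (acosh u) = u.
Proof. by move=> u1; rewrite /cosh expR_acosh// expRN_acosh//; lra. Qed.

Lemma acosh1 : acosh 1 = 0.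
Proof. by rewrite /acosh expr1n subrr sqrtr0 addr0 ln1. Qed.

Lemma acosh_triangle u v w : 1 <= u -> 1 <= v -> 1 <= w ->
  w <= u * v + Num.sqrt (u ^+ 2 - 1) * Num.sqrt (v ^+ 2 - 1) ->
  acosh w <= acosh u + acosh v.
Proof.
move=> u1 v1 w1 wuv.
rewrite -ler_expR expRD !expR_acosh//.
have su := sqrt_sqrB1 u1; have sv := sqrt_sqrB1 v1.
have su0 := sqrtr_ge0 (u ^+ 2 - 1); have sv0 := sqrtr_ge0 (v ^+ 2 - 1).
set a := Num.sqrt (u ^+ 2 - 1) in su su0 wuv *.
set b := Num.sqrt (v ^+ 2 - 1) in sv sv0 wuv *.
have -> : (u + a) * (v + b) = (u * v + a * b) + (u * b + a * v) by ring.
rewrite lerD//.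
have ub0 : 0 <= u * b + a * v.
  by rewrite addr_ge0// mulr_ge0// (le_trans ler01).
rewrite -[leRHS]ger0_norm// -sqrtr_sqr ler_sqrt ?sqr_ge0//.
have -> : (u * b + a * v) ^+ 2 = (u * v + a * b) ^+ 2 - 1.
  have -> : (u * b + a * v) ^+ 2 = u ^+ 2 * b ^+ 2 + a ^+ 2 * v ^+ 2 + 2 * (u * v * (a * b)) by ring.
  have -> : (u * v + a * b) ^+ 2 = u ^+ 2 * v ^+ 2 + a ^+ 2 * b ^+ 2 + 2 * (u * v * (a * b)) by ring.
  by rewrite su sv; ring.
by rewrite lerD2r lerXn2r// nnegrE (le_trans ler01)// (le_trans w1).
Qed.

End hyperbolic_functions.

Section hyperboloid.
Variables (R : realType) (V : lmodType R) (dp : {dot V for idfun}).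

Definition lorentz (p q : R * V) : R := p.1 * q.1 - dp p.2 q.2.

(* Upper sheet of the hyperboloid in the Lorentzian space [R (+) V]; its distance
   satisfies [cosh d = lorentz], see [cosh_mdist]. *)
Definition hyperboloid := {p : R * V | (0 < p.1) && (lorentz p p == 1)}.

HB.instance Definition _ := SubChoice.on hyperboloid.

Definition hyperbolic_dist (x y : hyperboloid) : R :=
  acosh (lorentz (\val x) (\val y)).

Let dpC u v : dp u v = dp v u.
Proof. by rewrite hermitian_subproof expr0 mul1r. Qed.

Let dpDl u v w : dp (u + v) w = dp u w + dp v w.
Proof. exact: linearDl. Qed.

Let dpZl a u w : dp (a *: u) w = a * dp u w.
Proof. exact: linearZl_LR. Qed.

Let dpDr u v w : dp w (u + v) = dp w u + dp w v.
Proof. by rewrite dpC dpDl !(dpC w). Qed.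

Let dpZr a u w : dp w (a *: u) = a * dp w u.
Proof. by rewrite dpC dpZl dpC. Qed.

Let dp0l w : dp 0 w = 0.
Proof. by rewrite -(scale0r (0 : V)) dpZl mul0r. Qed.

Let dp_ge0 u : 0 <= dp u u.
Proof.
have [->|u0] := eqVneq u 0; last by rewrite ltW// neq0_dnorm_gt0.
by rewrite dp0l.
Qed.

Let dp_eq0 u : dp u u = 0 -> u = 0.
Proof.
by move=> dp0; apply/eqP/negP => /negP /(neq0_dnorm_gt0 (s := dp)); rewrite dp0 ltxx.
Qed.

Let disc (a b c : R) : 0 <= c -> (forall t, 0 <= a + 2 * b * t + c * t ^+ 2) ->
  b ^+ 2 <= a * c.
Proof.
rewrite le_eqVlt => /predU1P[<- h|c0 h].
  have [->|b0] := eqVneq b 0; first by rewrite expr0n mulr0.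
  have := h (- (a + 1) / (2 * b)).
  have -> : a + 2 * b * (- (a + 1) / (2 * b)) + 0 * (- (a + 1) / (2 * b)) ^+ 2 = -1.
    by field.
  by rewrite ler0N1.
have := h (- b / c).
have -> : a + 2 * b * (- b / c) + c * (- b / c) ^+ 2 = (a * c - b ^+ 2) / c.
  by field; rewrite gt_eqF.
by rewrite pmulr_lge0 ?invr_gt0// subr_ge0.
Qed.

Let dp_CS u v : dp u v ^+ 2 <= dp u u * dp v v.
Proof.
apply: disc => // t.
have -> : dp u u + 2 * dp u v * t + dp v v * t ^+ 2 = dp (u + t *: v) (u + t *: v).
  by rewrite dpDl !dpDr !dpZl !dpZr (dpC v u); ring.
exact: dp_ge0.
Qed.

Let lorentzC p q : lorentz p q = lorentz q p.
Proof. by rewrite /lorentz mulrC dpC. Qed.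

Let comb (a : R) (p q : R * V) : R * V := (a * p.1 + q.1, a *: p.2 + q.2).

Let lorentz_combl a p q s : lorentz (comb a p q) s = a * lorentz p s + lorentz q s.
Proof. by rewrite /lorentz /comb/= dpDl dpZl; ring. Qed.

Let lorentz_combr a p q s : lorentz s (comb a p q) = a * lorentz s p + lorentz s q.
Proof. by rewrite lorentzC lorentz_combl !(lorentzC s). Qed.

Let perp_le0 (y : hyperboloid) e : lorentz e (\val y) = 0 ->
  lorentz e e <= 0 ?= iff (e == (0, 0)).
Proof.
case: y => -[y1 y2] /= /andP[/= y10 /eqP]; rewrite /lorentz/= => yy.
case: e => e1 e2 /= ey.
have CS := dp_CS e2 y2.
have ee0 := dp_ge0 e2.
have ey' : e1 * y1 = dp e2 y2 by lra.
have yy' : dp y2 y2 = y1 ^+ 2 - 1 by rewrite expr2; lra.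
have key : y1 ^+ 2 * (e1 * e1 - dp e2 e2) <= - dp e2 e2.
  have -> : y1 ^+ 2 * (e1 * e1 - dp e2 e2) = (e1 * y1) ^+ 2 - y1 ^+ 2 * dp e2 e2 by ring.
  by rewrite ey'; rewrite yy' in CS; lra.
have y20 : 0 < y1 ^+ 2 by rewrite exprn_gt0.
split.
  by rewrite -(pmulr_rle0 _ y20); lra.
apply/eqP/eqP => [H|[-> ->]]; last first.
  by rewrite mul0r dp0l subr0.
have e20 : e2 = 0.
  by apply: dp_eq0; apply/eqP; rewrite eq_le ee0 andbT; rewrite H mulr0 in key; lra.
move: H; rewrite e20 dp0l subr0 => /eqP.
by rewrite mulf_eq0 orbb => /eqP ->.
Qed.

Lemma lorentz_ge1 (x y : hyperboloid) : 1 <= lorentz (\val x) (\val y).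
Proof.
case: x => -[x1 x2] /= /andP[/= x10 /eqP]; rewrite /lorentz/= => xx.
case: y => -[y1 y2] /= /andP[/= y10 /eqP]; rewrite /lorentz/= => yy.
have CS := dp_CS x2 y2.
have xx0 := dp_ge0 x2; have yy0 := dp_ge0 y2.
have xy1 : 1 <= x1 * y1.
  have x11 : 1 <= x1 by nra.
  have y11 : 1 <= y1 by nra.
  by rewrite -[1]mulr1 ler_pM.
suff : dp x2 y2 <= x1 * y1 - 1 by lra.
rewrite (le_trans (ler_norm _))// -(@ler_pXn2r _ 2)// ?nnegrE ?subr_ge0//.
rewrite real_normK ?num_real// (le_trans CS)//.
have -> : dp x2 x2 = x1 * x1 - 1 by lra.
have -> : dp y2 y2 = y1 * y1 - 1 by lra.
by have := sqr_ge0 (x1 - y1); lra.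
Qed.

Lemma cosh_hyperbolic_dist x y :
  cosh (hyperbolic_dist x y) = lorentz (\val x) (\val y).
Proof. by rewrite acoshK// lorentz_ge1. Qed.

Let lorentz_xx (x : hyperboloid) : lorentz (\val x) (\val x) = 1.
Proof. by case: x => p /= /andP[_ /eqP]. Qed.

Let hdistxx x : hyperbolic_dist x x = 0.
Proof. by rewrite /hyperbolic_dist lorentz_xx acosh1. Qed.

Let hdistC x y : hyperbolic_dist x y = hyperbolic_dist y x.
Proof. by rewrite /hyperbolic_dist lorentzC. Qed.

Let hdist_eq0 x y : hyperbolic_dist x y = 0 -> x = y.
Proof.
move=> xy0; have := cosh_hyperbolic_dist x y.
rewrite xy0 /cosh oppr0 expR0 => xy1.
pose e := comb (-1) (\val y) (\val x).
have ey : lorentz e (\val y) = 0.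
  by rewrite lorentz_combl lorentz_xx -xy1; lra.
have [_] := perp_le0 ey.
rewrite !(lorentz_combl, lorentz_combr) !lorentz_xx (lorentzC (\val y)) -xy1.
have -> : -1 * (-1 * 1 + (1 + 1) / 2) + (-1 * ((1 + 1) / 2) + 1) = 0 :> R by lra.
rewrite eqxx => /esym/eqP[].
rewrite scaleN1r mulN1r => /eqP + /eqP; rewrite addrC subr_eq0 addrC subr_eq0 => /eqP h1 /eqP h2.
by apply: val_inj => /=; rewrite [LHS]surjective_pairing [RHS]surjective_pairing h1 h2.
Qed.

Let hdist_triangle y x z :
  hyperbolic_dist x z <= hyperbolic_dist x y + hyperbolic_dist y z.
Proof.
apply: acosh_triangle; rewrite ?lorentz_ge1//.
set a := lorentz (\val x) (\val y); set b := lorentz (\val y) (\val z).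
pose u := comb (- a) (\val y) (\val x); pose w := comb (- b) (\val y) (\val z).
have uy : lorentz u (\val y) = 0 by rewrite lorentz_combl lorentz_xx /a; lra.
have wy : lorentz w (\val y) = 0.
  by rewrite lorentz_combl lorentz_xx lorentzC -/b; lra.
have uu : lorentz u u = 1 - a ^+ 2.
  rewrite !(lorentz_combl, lorentz_combr) !lorentz_xx (lorentzC (\val y) (\val x)) -/a; ring.
have ww : lorentz w w = 1 - b ^+ 2.
  rewrite !(lorentz_combl, lorentz_combr) !lorentz_xx (lorentzC (\val z) (\val y)) -/b; ring.
have uw : lorentz u w = lorentz (\val x) (\val z) - a * b.
  rewrite !(lorentz_combl, lorentz_combr) !lorentz_xx -/a -/b; ring.
clearbody u w.
have CS : lorentz u w ^+ 2 <= (a ^+ 2 - 1) * (b ^+ 2 - 1).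
  have -> : lorentz u w ^+ 2 = (- lorentz u w) ^+ 2 by rewrite sqrrN.
  apply: disc => [|t].
    by have [] := perp_le0 wy; rewrite ww; lra.
  have ty : lorentz (comb t w u) (\val y) = 0 by rewrite lorentz_combl uy wy; lra.
  have [+ _] := perp_le0 ty.
  rewrite !(lorentz_combl, lorentz_combr) (lorentzC w u) uu ww; lra.
suff : lorentz u w <= Num.sqrt (a ^+ 2 - 1) * Num.sqrt (b ^+ 2 - 1) by rewrite uw; lra.
rewrite -sqrtrM; last by rewrite subr_ge0 exprn_ege1// lorentz_ge1.
rewrite (le_trans (ler_norm _))// -sqrtr_sqr ler_sqrt//.
by rewrite mulr_ge0// subr_ge0 exprn_ege1// lorentz_ge1.
Qed.

HB.instance Definition _ := isMetric.Build R hyperboloid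
  hdistxx hdist_eq0 hdistC hdist_triangle.

Lemma cosh_mdist (x y : hyperboloid) :
  cosh (mdist x y) = lorentz (\val x) (\val y).
Proof. exact: cosh_hyperbolic_dist. Qed.

End hyperboloid.

Section models.
Variable R : realType.

Definition dot_rV N (u v : 'rV[R]_N) : R := (u *m v^T) 0 0.

Let dot_rV_bilinear N : bilinear_for
  (GRing.Scale.Law.clone _ _ *%R _) (GRing.Scale.Law.clone _ _ (idfun \; *%R) _)
  (@dot_rV N).
Proof.
split=> w a u v /=; rewrite /dot_rV.
  by rewrite mulmxDl -scalemxAl !mxE.
by rewrite linearP/= mulmxDr -scalemxAr !mxE.
Qed.

HB.instance Definition _ N :=
  bilinear_isBilinear.Build R 'rV[R]_N 'rV[R]_N R _ _ (@dot_rV N)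
    (dot_rV_bilinear N).

Let dot_rV_sym N (u v : 'rV[R]_N) :
  dot_rV u v = (-1) ^+ false * idfun (dot_rV v u).
Proof.
rewrite expr0 mul1r /dot_rV/=.
have -> : v *m u^T = (u *m v^T)^T by rewrite trmx_mul trmxK.
by rewrite [RHS]mxE.
Qed.

HB.instance Definition _ N :=
  isHermitianSesquilinear.Build R 'rV[R]_N false idfun (@dot_rV N)
    (@dot_rV_sym N).

Let dot_rV_gt0 N (u : 'rV[R]_N) : u != 0 -> 0 < dot_rV u u.
Proof.
move=> u0; rewrite /dot_rV mxE lt_neqAle; apply/andP; split; last first.
  by apply: sumr_ge0 => i _; rewrite mxE -expr2 sqr_ge0.
apply: contra u0; rewrite eq_sym => /eqP s0; apply/eqP/rowP => i.
have /psumr_eq0P : forall j, true -> 0 <= u 0 j * u^T j 0.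
  by move=> j _; rewrite mxE -expr2 sqr_ge0.
move=> /(_ s0 i isT); rewrite !mxE => /eqP.
by rewrite mulf_eq0 orbb => /eqP.
Qed.

HB.instance Definition _ N :=
  isDotProduct.Build R 'rV[R]_N (@dot_rV N) (@dot_rV_gt0 N).

Definition square_summable : {pred nat -> R^o} :=
  fun u => `[< cvgn (series (fun n => u n ^+ 2)) >].

Let square_summable_le (u v : nat -> R) : (forall n, 0 <= u n <= v n) ->
  cvgn (series v) -> cvgn (series u).
Proof.
by move=> uv; apply: series_le_cvg => n; have /andP[]// := uv n; exact: le_trans.
Qed.

Let square_summable_submod : submod_closed square_summable.
Proof.
split=> [|a u v /asboolP su /asboolP sv]; apply/asboolP.
  rewrite (_ : series _ = cst 0); first exact: is_cvg_cst.
  by apply/funext => n; rewrite /series/= big1// => i _; rewrite expr0n.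
apply: (@square_summable_le _ (fun n => 2 * a ^+ 2 * u n ^+ 2 + 2 * v n ^+ 2)).
  move=> n; rewrite sqr_ge0 /=.
  have -> : (a *: u + v) n = a * u n + v n :> R by [].
  have H (b c : R) : (a * b + c) ^+ 2 <= 2 * a ^+ 2 * b ^+ 2 + 2 * c ^+ 2.
    rewrite -subr_ge0; have -> : 2 * a ^+ 2 * b ^+ 2 + 2 * c ^+ 2 -
      (a * b + c) ^+ 2 = (a * b - c) ^+ 2 by ring.
    exact: sqr_ge0.
  exact: H.
rewrite (_ : series _ = (2 * a ^+ 2) *: series (fun n => u n ^+ 2) +
  2 *: series (fun n => v n ^+ 2)).
  by apply: is_cvgD; exact: is_cvgZr.
apply/funext => n; rewrite /series/= !fctE/= /GRing.scale/=.
by rewrite big_split/= !mulr_sumr.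
Qed.

HB.instance Definition _ := GRing.isSubmodClosed.Build R (nat -> R^o)
  square_summable square_summable_submod.

Definition ell2 := {u : nat -> R^o | square_summable u}.
HB.instance Definition _ := SubChoice.on ell2.
HB.instance Definition _ := [SubChoice_isSubZmodule of ell2 by <:].
HB.instance Definition _ := [SubZmodule_isSubLmodule of ell2 by <:].

Definition dot_ell2 (u v : ell2) : R :=
  limn (series (fun n => (\val u n : R) * \val v n)).

Lemma is_cvg_dot_ell2 (u v : ell2) :
  cvgn (series (fun n => (\val u n : R) * \val v n)).
Proof.
apply: normed_cvg; apply: (@square_summable_le _
    (fun n => \val u n ^+ 2 + \val v n ^+ 2 : R)).
  move=> n /=; rewrite normr_ge0 normrM/=.
  have H (b c : R) : `|b| * `|c| <= b ^+ 2 + c ^+ 2.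
    rewrite -(real_normK (num_real b)) -(real_normK (num_real c)).
    have := sqr_ge0 (`|b| - `|c|).
    have := mulr_ge0 (normr_ge0 b) (normr_ge0 c); nra.
  exact: H.
rewrite (_ : series _ = series (fun n => \val u n ^+ 2 : R) +
  series (fun n => \val v n ^+ 2 : R)).
  by apply: is_cvgD; [case: u => u /= /asboolP|case: v => v /= /asboolP].
by apply/funext => n; rewrite /series/= !fctE/= big_split.
Qed.

Let dot_ell2C u v : dot_ell2 u v = dot_ell2 v u.
Proof. by rewrite /dot_ell2; under eq_fun do rewrite mulrC. Qed.

Let dot_ell2P w a u v : dot_ell2 (a *: u + v) w = a * dot_ell2 u w + dot_ell2 v w.
Proof.
rewrite /dot_ell2; apply/cvg_lim => //.
rewrite (_ : series _ = a *: series (fun n => \val u n * \val w n : R) +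
    series (fun n => \val v n * \val w n : R)).
  apply: cvgD; last exact: is_cvg_dot_ell2.
  by apply: cvgZr; exact: is_cvg_dot_ell2.
have E n : \val (a *: u + v) n = a * \val u n + \val v n :> R.
  by [].
under eq_fun do rewrite E.
apply/funext => n; rewrite /series/= !fctE/= /GRing.scale/=.
by rewrite mulr_sumr -big_split/=; apply: eq_bigr => i _; ring.
Qed.

Let dot_ell2_bilinear : bilinear_for
  (GRing.Scale.Law.clone _ _ *%R _) (GRing.Scale.Law.clone _ _ (idfun \; *%R) _)
  dot_ell2.
Proof.
split=> w a u v /=; first exact: dot_ell2P.
by rewrite dot_ell2C dot_ell2P !(dot_ell2C w).
Qed.

HB.instance Definition _ :=
  bilinear_isBilinear.Build R ell2 ell2 R _ _ dot_ell2 dot_ell2_bilinear.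

Let dot_ell2_sym u v : dot_ell2 u v = (-1) ^+ false * idfun (dot_ell2 v u).
Proof. by rewrite expr0 mul1r/= dot_ell2C. Qed.

HB.instance Definition _ :=
  isHermitianSesquilinear.Build R ell2 false idfun dot_ell2 dot_ell2_sym.

Let dot_ell2_gt0 u : u != 0 -> 0 < dot_ell2 u u.
Proof.
move=> u0; have [n un] : exists n, \val u n != 0 :> R.
  apply: contrapT => /forallNP H; move/eqP: u0; apply; apply: val_inj.
  by apply/funext => n; have /negP := H n; rewrite negbK => /eqP ->.
have le k : (fun i => series (fun n => \val u n * \val u n : R) i) k <= dot_ell2 u u.
  apply: nondecreasing_cvgn_le; last exact: is_cvg_dot_ell2.
  by apply: nondecreasing_series => i _ _; rewrite -expr2 sqr_ge0.
apply: lt_le_trans (le n.+1).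
rewrite /series/= big_nat_recr//= ltr_wpDl//; last first.
  by rewrite -expr2 exprn_even_gt0.
by apply: sumr_ge0 => i _; rewrite -expr2 sqr_ge0.
Qed.

HB.instance Definition _ := isDotProduct.Build R ell2 dot_ell2 dot_ell2_gt0.

Definition hyperbolic_space N := hyperboloid (@dot_rV N).
HB.instance Definition _ N := Metric.on (hyperbolic_space N).

Definition hyperbolic_space_oo := hyperboloid dot_ell2.
HB.instance Definition _ := Metric.on hyperbolic_space_oo.

End models.

Section subspace_metric.
Variables (R : realType) (X : metricType R) (A : set X).

Let sub_mdist (x y : A) : R := mdist (\val x) (\val y).

Let sub_mdist_ge0 x y : 0 <= sub_mdist x y.
Proof. exact: mdist_ge0. Qed.

Let sub_mdist_eq0 x y : sub_mdist x y = 0 -> x = y.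
Proof. by move=> /mdist_positivity /val_inj. Qed.

Let sub_ballE (x : A) (e : R) : ball x e = [set y | sub_mdist x y < e].
Proof.
have -> : ball x e = (\val : A -> X) @^-1` ball (\val x) e by [].
by rewrite ballEmdist.
Qed.

HB.instance Definition _ :=
  PseudoMetric_isMetric.Build R A sub_mdist_ge0 sub_mdist_eq0 sub_ballE.

End subspace_metric.

Section isometry_group.
Variables (R : realType) (X : metricType R).

Record isom := Isom {
  isom_fun :> X -> X ;
  isom_bij : bijective isom_fun ;
  isom_mdist : forall x y, mdist (isom_fun x) (isom_fun y) = mdist x y }.

Lemma isom_eqP (f g : isom) : f =1 g -> f = g.
Proof.
case: f g => f f1 f2 [g g1 g2] /= /funext fg; subst g.
by congr Isom; exact: Prop_irrelevance.
Qed.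

HB.instance Definition _ := gen_eqMixin isom.
HB.instance Definition _ := gen_choiceMixin isom.

Definition isom1 : isom := @Isom idfun (inv_bij (fun=> erefl)) (fun _ _ => erefl).

Let comp_mdist (f g : isom) x y : mdist ((f \o g) x) ((f \o g) y) = mdist x y.
Proof. by rewrite /= !isom_mdist. Qed.

Definition isom_comp (f g : isom) : isom :=
  Isom (bij_comp (isom_bij f) (isom_bij g)) (comp_mdist f g).

Let isom_inv_ex (f : isom) : exists g : X -> X, cancel f g /\ cancel g f.
Proof. by have [g fg gf] := isom_bij f; exists g. Qed.

Let inv_fun (f : isom) : X -> X := sval (cid (isom_inv_ex f)).

Let inv_funK (f : isom) : cancel f (inv_fun f).
Proof. exact: (svalP (cid (isom_inv_ex f))).1. Qed.

Let inv_funKV (f : isom) : cancel (inv_fun f) f.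
Proof. exact: (svalP (cid (isom_inv_ex f))).2. Qed.

Let inv_mdist (f : isom) x y : mdist (inv_fun f x) (inv_fun f y) = mdist x y.
Proof. by rewrite -(isom_mdist f) !inv_funKV. Qed.

Definition isom_inv (f : isom) : isom :=
  Isom (Bijective (inv_funKV f) (inv_funK f)) (inv_mdist f).

Let isom_compA : associative isom_comp.
Proof. by move=> f g h; exact: isom_eqP. Qed.
Let isom_comp1f : left_id isom1 isom_comp.
Proof. by move=> f; exact: isom_eqP. Qed.
Let isom_compf1 : right_id isom1 isom_comp.
Proof. by move=> f; exact: isom_eqP. Qed.
Let isom_compVf : left_inverse isom1 isom_inv isom_comp.
Proof. by move=> f; apply: isom_eqP => x /=; rewrite inv_funK. Qed.
Let isom_compfV : right_inverse isom1 isom_inv isom_comp.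
Proof. by move=> f; apply: isom_eqP => x /=; rewrite inv_funKV. Qed.

HB.instance Definition _ := isGroup.Build isom
  isom_compA isom_comp1f isom_compf1 isom_compVf isom_compfV.

End isometry_group.

Section asymptotic_cone.
Variables (R : realType) (X : metricType R) (r : nat -> {nonneg R}) (o : nat -> X).
Variables (omega : set_system nat) (Uomega : UltraFilter omega).

Let ufilter : ProperFilter omega := @ultra_proper _ _ Uomega.
Local Existing Instance ufilter.

Definition rescaled_dist (x y : nat -> X) (k : nat) : R :=
  mdist (x k) (y k) / (r k)%:num.

(* Convergence in [R], hence to a finite limit. *)
Definition finite_distance : {pred nat -> X} :=
  fun x => `[< cvg (rescaled_dist x o @ omega) >].

Definition cone_seq := {x : nat -> X | finite_distance x}.
HB.instance Definition _ := SubChoice.on cone_seq.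

Let rd_ge0 x y k : 0 <= rescaled_dist x y k.
Proof. by rewrite divr_ge0// mdist_ge0. Qed.

Let rdC x y : rescaled_dist x y = rescaled_dist y x.
Proof. by apply/funext => k; rewrite /rescaled_dist metric_sym. Qed.

Let rdxx x : rescaled_dist x x = cst 0.
Proof. by apply/funext => k; rewrite /rescaled_dist mdistxx mul0r. Qed.

Let rd_triangle y x z k :
  rescaled_dist x z k <= rescaled_dist x y k + rescaled_dist y z k.
Proof. by rewrite -mulrDl ler_wpM2r// ?invr_ge0// metric_triangle. Qed.

Let ultra_cvg_bounded (u : nat -> R) (c : R) :
  (\forall k \near omega, 0 <= u k <= c) -> cvg (u @ omega).
Proof.
move=> uc.
have : compact `[0, c]%classic := @segment_compact R 0 c.
rewrite compact_ultra => /(_ (u @ omega)) [].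
- split; first exact: fmap_proper_filter.
  move=> G PG uG.
  rewrite eqEsubset; split => // A GA.
  have [//|uA] := in_ultra_setVsetC (u @^-1` A) Uomega.
  have GCA : G (~` A) by apply: uG.
  by have [x []] := @filter_ex _ _ PG _ (filterI GA GCA).
- by apply: filterS uc => k; rewrite /= in_itv.
- by move=> l [_ ul]; apply/cvg_ex; exists l.
Qed.

Let cone_seq_cvg (x y : cone_seq) :
  cvg (rescaled_dist (\val x) (\val y) @ omega).
Proof.
have bound (z : cone_seq) :
    \forall k \near omega, rescaled_dist (\val z) o k <= lim (rescaled_dist (\val z) o @ omega) + 1.
  case: z => z /= /asboolP zo.
  near=> k; apply: ltW; near: k.
  by apply: (cvgr_lt _ zo); rewrite ltrDl.
apply: (@ultra_cvg_bounded _ (lim (rescaled_dist (\val x) o @ omega) + 1 +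
  (lim (rescaled_dist (\val y) o @ omega) + 1))).
near=> k; rewrite rd_ge0/= (le_trans (rd_triangle o _ _ _))// lerD//.
  by near: k; exact: bound.
by rewrite rdC; near: k; exact: bound.
Unshelve. all: by end_near. Qed.

Definition cone_eq (x y : cone_seq) : bool :=
  `[< rescaled_dist (\val x) (\val y) @ omega --> 0 >].

Let rd_cvg0_trans y x z : rescaled_dist x y @ omega --> 0 ->
  rescaled_dist y z @ omega --> 0 -> rescaled_dist x z @ omega --> 0.
Proof.
move=> xy yz; have xyz : rescaled_dist x y + rescaled_dist y z @ omega --> 0.
  by rewrite -(addr0 0); exact: cvgD.
apply: squeeze_cvgr (cvg_cst _) xyz.
by apply: nearW => k; rewrite rd_ge0 rd_triangle.
Qed.

Let cone_eq_refl : reflexive cone_eq.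
Proof. by move=> x; apply/asboolP; rewrite rdxx; exact: cvg_cst. Qed.

Let cone_eq_sym : symmetric cone_eq.
Proof. by move=> x y; rewrite /cone_eq rdC. Qed.

Let cone_eq_trans : transitive cone_eq.
Proof.
move=> y x z /asboolP xy /asboolP yz; apply/asboolP.
exact: rd_cvg0_trans xy yz.
Qed.

Canonical cone_equiv := EquivRel cone_eq cone_eq_refl cone_eq_sym cone_eq_trans.

Definition asymptotic_cone := {eq_quot cone_equiv}.
HB.instance Definition _ := EqQuotient.on asymptotic_cone.
HB.instance Definition _ := Choice.on asymptotic_cone.

Definition cone_mdist (p q : asymptotic_cone) : R :=
  lim (rescaled_dist (\val (repr p)) (\val (repr q)) @ omega).

Let cone_mdistxx p : cone_mdist p p = 0.
Proof. by rewrite /cone_mdist rdxx; exact: lim_cst. Qed.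

Let cone_mdistC p q : cone_mdist p q = cone_mdist q p.
Proof. by rewrite /cone_mdist rdC. Qed.

Let cone_mdist_eq0 p q : cone_mdist p q = 0 -> p = q.
Proof.
move=> pq; rewrite -[p]reprK -[q]reprK; apply/eqmodP/asboolP.
by rewrite -pq; exact: cone_seq_cvg.
Qed.

Let cone_mdist_triangle q p s :
  cone_mdist p s <= cone_mdist p q + cone_mdist q s.
Proof.
rewrite /cone_mdist -limD; [|exact: cone_seq_cvg|exact: cone_seq_cvg].
apply: ler_lim; [exact: cone_seq_cvg|apply: is_cvgD; exact: cone_seq_cvg|].
by apply: nearW => k; exact: rd_triangle.
Qed.

HB.instance Definition _ := isMetric.Build R asymptotic_cone
  cone_mdistxx cone_mdist_eq0 cone_mdistC cone_mdist_triangle.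

Let base_finite_distance : finite_distance o.
Proof. by apply/asboolP; rewrite rdxx; exact: is_cvg_cst. Qed.

Definition cone_base_seq : cone_seq := exist _ o base_finite_distance.

(* Class of a sequence of points; the base point if the sequence is not at
   finite distance from [o]. *)
Definition cone_class (x : nat -> X) : asymptotic_cone :=
  \pi_asymptotic_cone (insubd cone_base_seq x).

Definition cone_base : asymptotic_cone := cone_class o.

Lemma cone_mdist_class (x y : nat -> X) :
  finite_distance x -> finite_distance y ->
  rescaled_dist x y @ omega --> mdist (cone_class x) (cone_class y).
Proof.
move=> fx fy; pose x' : cone_seq := exist _ x fx; pose y' : cone_seq := exist _ y fy.
have xE : insubd cone_base_seq x = x' by apply: val_inj; rewrite val_insubd fx.
have yE : insubd cone_base_seq y = y' by apply: val_inj; rewrite val_insubd fy.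
have repr0 (z : cone_seq) :
    rescaled_dist (\val z) (\val (repr (\pi_asymptotic_cone z))) @ omega --> 0.
  have : z == repr (\pi_asymptotic_cone z) %[mod asymptotic_cone] by rewrite reprK.
  by rewrite eqmodE => /asboolP.
have xy := @cone_seq_cvg x' y'.
rewrite /cone_class xE yE.
set p := \pi_asymptotic_cone x'; set q := \pi_asymptotic_cone y'.
suff -> : mdist p q = lim (rescaled_dist x y @ omega) by [].
apply/cvg_lim => //.
have hx := repr0 x'; have hy := repr0 y'.
pose e := rescaled_dist x (\val (repr p)) + rescaled_dist y (\val (repr q)).
apply: (squeeze_cvgr (f := rescaled_dist x y - e) (h := rescaled_dist x y + e)).
- apply: nearW => k; apply/andP; split.
    have := rd_triangle (\val (repr p)) x y k.
    have := rd_triangle (\val (repr q)) (\val (repr p)) y k.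
    by rewrite /e !fctE (rdC (\val (repr q)) y); lra.
  have := rd_triangle x (\val (repr p)) (\val (repr q)) k.
  have := rd_triangle y x (\val (repr q)) k.
  by rewrite /e !fctE (rdC (\val (repr p)) x); lra.
- rewrite -[X in _ --> X]subr0; apply: cvgB => //.
  by rewrite -[X in _ --> X]addr0; exact: cvgD.
- rewrite -[X in _ --> X]addr0; apply: cvgD => //.
  by rewrite -[X in _ --> X]addr0; exact: cvgD.
Qed.

End asymptotic_cone.

Section hyperbolic_subspaces.
Variables (R : realType) (V : lmodType R) (dp : {dot V for idfun}).

Definition closed_linear_subspace (L : set (R * V)) : Prop :=
  [/\ L (0, 0),
      forall a p q, L p -> L q -> L (a * p.1 + q.1, a *: p.2 + q.2) &
      forall p, (forall e, 0 < e -> exists2 q, L q &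
        (p.1 - q.1) ^+ 2 + dp (p.2 - q.2) (p.2 - q.2) < e) -> L p].

(* The improper subspace [setT] is included. *)
Definition closed_hyperbolic_subspace (A : set (hyperboloid dp)) : Prop :=
  exists2 L, closed_linear_subspace L & A = [set x | L (\val x)].

Definition total_set (B : set (hyperboloid dp)) : Prop :=
  forall A, closed_hyperbolic_subspace A -> B `<=` A -> A = setT.

End hyperbolic_subspaces.

Section boundary.
Variables (R : realType) (V : lmodType R) (dp : {dot V for idfun}).
Local Notation H := (hyperboloid dp).

(* A unit vector [u] stands for the isotropic half-line spanned by [(1, u)]. *)
Definition boundary := {u : V | dp u u == 1}.

Definition klein (x : H) : V := (\val x).1^-1 *: (\val x).2.

(* Traces on the hyperboloid of the neighbourhoods of a boundary point, in the
   closed unit ball of the Klein model. *)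
Definition boundary_nbhs (xi : boundary) : set_system H :=
  filter_from [set e | 0 < e]
    (fun e => [set x | dp (klein x - \val xi) (klein x - \val xi) < e ^+ 2]).

Definition gromov_product (o x y : H) : R :=
  (mdist o x + mdist o y - mdist x y) / 2.

(* In curvature -1 the Gromov product extends continuously to the boundary, with
   value [+oo] exactly on the diagonal. *)
Definition boundary_gromov_product (o : H) (xi zeta : boundary) : \bar R :=
  lim ((gromov_product o p.1 p.2)%:E
         @[p --> filter_prod (boundary_nbhs xi) (boundary_nbhs zeta)]).

Definition visual_dist (o : H) (xi zeta : boundary) : R :=
  fine (expeR (- boundary_gromov_product o xi zeta)).

Definition limit_set (G : Type) (rho : G -> isom H) (o : H) : set boundary :=
  [set xi | forall A, boundary_nbhs xi A -> exists g, A (rho g o)].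

End boundary.

Section hausdorff_dimension.
Variables (R : realType) (X : Type) (d : X -> X -> R).
Local Open Scope ereal_scope.

Definition diameter (U : set X) : \bar R :=
  maxe 0 (ereal_sup [set (d x.1 x.2)%:E | x in U `*` U]).

Definition hausdorff_content (s delta : R) (A : set X) : \bar R :=
  ereal_inf [set \sum_(0 <= i <oo) (diameter (U i) `^ s) |
    U in [set U : nat -> set X |
      A `<=` \bigcup_i U i /\ forall i, diameter (U i) <= delta%:E]].

Definition hausdorff_measure (s : R) (A : set X) : \bar R :=
  ereal_sup [set hausdorff_content s delta A | delta in [set delta | (0 < delta)%R]].

(* Restricting to [s > 0] does not change the infimum and avoids [0 `^ 0 = 1]. *)
Definition hausdorff_dim (A : set X) : \bar R :=
  ereal_inf [set s%:E | s in [set s | (0 < s)%R /\ hausdorff_measure s A = 0]].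

End hausdorff_dimension.

Section kernels.
Variable R : realType.

Definition hyperbolic_kernel (X : Type) (beta : X -> X -> R) : Prop :=
  [/\ forall x y, beta x y = beta y x,
      forall x y, 0 <= beta x y,
      forall x, beta x x = 1 &
      forall n (x0 : X) (x : 'I_n -> X) (c : 'I_n -> R),
        \sum_(i < n) \sum_(j < n) c i * c j * beta (x i) (x j) <=
        (\sum_(k < n) c k * beta x0 (x k)) ^+ 2].

Definition cosh_pow (X : metricType R) (t : R) (x y : X) : R :=
  cosh (mdist x y) `^ t.

Definition exp_dist (X : metricType R) (x y : X) : R := expR (mdist x y).

Definition has_kernel (X : Type) (beta : X -> X -> R)
    (f : X -> hyperbolic_space_oo R) : Prop :=
  forall x y, cosh (mdist (f x) (f y)) = beta x y.

Definition kernel_embedding (X : metricType R) (beta : X -> X -> R)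
    (f : X -> hyperbolic_space_oo R) : Prop :=
  [/\ continuous f, injective f, total_set (range f) & has_kernel beta f].

Definition stability_constant (X1 : metricType R) (beta1 : X1 -> X1 -> R)
    (F1 : X1 -> hyperbolic_space_oo R) (e : R) (K : set X1) (eta : R) : Prop :=
  0 < eta /\
  forall (X2 : metricType R) (phi : K -> X2) (beta2 : X2 -> X2 -> R)
      (f2 : X2 -> hyperbolic_space_oo R),
    injective phi -> hyperbolic_kernel beta2 -> has_kernel beta2 f2 ->
    (forall x y : K,
      `|beta2 (phi x) (phi y) - beta1 (\val x) (\val y)| <= eta) ->
    exists F : isom (hyperbolic_space_oo R),
      forall x : K, mdist (F (F1 (\val x))) (f2 (phi x)) <= e.

End kernels.

Section groups.
Variable G : groupType.

Definition symmetric_generating (S : seq G) : Prop :=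
  (forall s, s \in S -> (s^-1)%g \in S) /\
  forall g, exists2 w : seq G, {subset w <= S} & g = \big[*%g/1%g]_(s <- w) s.

Variables (n : nat) (b : 'I_n -> G).

(* The letter [(i, true)] is [b i] and [(i, false)] its inverse. *)
Definition word_val (w : seq ('I_n * bool)) : G :=
  \big[*%g/1%g]_(a <- w) (if a.2 then b a.1 else (b a.1)^-1%g).

Definition reduced (w : seq ('I_n * bool)) : bool :=
  sorted [rel a c | (a.1 == c.1) ==> (a.2 == c.2)] w.

Definition free_basis : Prop :=
  forall g, exists! w, reduced w /\ word_val w = g.

Definition word_length (g : G) : nat :=
  xget 0%N [set m | (exists2 w, size w = m & word_val w = g) /\
    forall w, word_val w = g -> (m <= size w)%N].

End groups.

Section actions.
Variables (R : realType) (X : metricType R) (G : groupType).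

Definition displacement (S : seq G) (rho : G -> isom X) (x : X) : R :=
  \big[Num.max/0]_(s <- S) mdist x (rho s x).

Definition min_displacement (S : seq G) (rho : G -> isom X) : R :=
  inf (range (displacement S rho)).

(* Computed on a representative of [p]; the class does not depend on it. *)
Definition cone_action (r : nat -> {nonneg R}) (o : nat -> X)
    (omega : set_system nat) (Uomega : UltraFilter omega)
    (rho : nat -> G -> isom X) (g : G) (p : asymptotic_cone r o Uomega) :
    asymptotic_cone r o Uomega :=
  cone_class r o Uomega (fun k => rho k g (\val (repr p) k)).

Definition geodesically_convex (A : set X) : Prop :=
  forall (L : R) (c : R -> X),
    {in `[0, L] &, forall s t, mdist (c s) (c t) = `|s - t|} ->
    A (c 0) -> A (c L) -> {in `[0, L], forall s, A (c s)}.

(* In a real tree, the subtrees are the nonempty convex subsets. *)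
Definition invariant_subtree (act : G -> X -> X) (A : set X) : Prop :=
  [/\ A !=set0, closed A, geodesically_convex A &
      forall g x, A x -> A (act g x)].

Definition minimal_subtree (act : G -> X -> X) (A : set X) : Prop :=
  invariant_subtree act A /\
  forall B, invariant_subtree act B -> B `<=` A -> B = A.

Definition schottky n (b : 'I_n -> G) (rho : G -> isom X) : Prop :=
  exists (K : R) (o : X), 1 <= K /\
    forall g h : G,
      K^-1 * (word_length b (g^-1 * h)%g)%:R - K <= mdist (rho g o) (rho h o) /\
      mdist (rho g o) (rho h o) <= K * (word_length b (g^-1 * h)%g)%:R + K.

End actions.

Section approximations.
Variables (R : realType) (X T : metricType R) (G : groupType).
Variables (r : nat -> {nonneg R}) (rho : nat -> G -> isom X) (rho_oo : G -> isom T).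
Variables (x : nat -> T) (Gam : nat -> set G) (eta : R -> set T -> R).

Definition first_points (l : nat) : set T := [set x i | i in [set i | (i <= l)%N]].

Definition translates (l : nat) : set T :=
  [set rho_oo g y | g in Gam l & y in first_points l].

Definition tree_approximation (k l : nat) (e : R) (K : set X) (Rel : T -> X -> Prop) :
    Prop :=
  [/\ finite_set K,
      forall y z, Rel y z -> first_points l y /\ K z,
      forall y, first_points l y -> exists z, Rel y z,
      forall z, K z -> exists y, Rel y z &
      forall y y' g g' z z', Gam l g -> Gam l g' -> Rel y z -> Rel y' z' ->
        `|mdist (rho_oo g y) (rho_oo g' y') -
          mdist (rho k g z) (rho k g' z') / (r k)%:num| <= e /\
        `|exp_dist (rho_oo g y) (rho_oo g' y') -
          cosh_pow (r k)%:num^-1 (rho k g z) (rho k g' z')| <=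
        eta e (translates l)].

(* Only the indices with [r k > 1], i.e. [0 < (r k)^-1 < 1], are considered. *)
Definition approximable (l : nat) (e : R) : set nat :=
  [set k | 1 < (r k)%:num /\ exists K Rel, tree_approximation k l e K Rel].

End approximations.

(* Main.v *)
Require Import Defs.
From mathcomp Require Import all_boot all_order all_algebra.
From mathcomp Require Import all_classical all_reals all_analysis.
From mathcomp Require Import ring lra.

(**
 Convergence.  On the points [F1 (x l)], the choice of [I k] says directly that
 [Rep k g (F1 (x l))] is within [2 eps (ell k)] of [Rep_oo g (F1 (x l))].  These
 points are dense in the total set [range F1], and pointwise convergence of
 isometries of the hyperboloid on a total set propagates everywhere
 ([isom_cvg_total]): the vectors against which the Lorentz product converges form a
 closed linear subspace.

 Dimension.  For every [e] in (0, 1) and every large [k], the limit sets of [Rep k]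
 and [Rep_oo] correspond to each other by a relation that is [(1 - e)]-Hoelder in
 both directions for the visual distances, which forces the ratio of the
 dimensions between [1 - e] and [(1 - e)^-1] ([limit_set_dim_le],
 [squeeze_ratio]).  The Hoelder estimate
 is one on Gromov products of orbit points,
     (1 - e) (g p|h p)_oo - C <= (g p|h p)_k,   and symmetrically,
 which passes to the limit set because the Gromov product is, up to a bounded error, the
 logarithm of an explicit function of Klein coordinates ([chord_gprod],
 [visual_distE]).  Completeness of the Hilbert space provides the
 corresponding limit points ([corresponding_limit_exists]).

 The estimate on Gromov products has two sources ([orbit_gprod_stable]).
 - For [Rep_oo], the orbit paths of reduced words turn back by a bounded amount only.
   The asymptotic cone is a limit of rescalings of a Gromov hyperbolic
   space, hence 0-hyperbolic ([cone_zero_hyperbolic]); there quasi-geodesics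
   stay close to geodesics by an elementary argument
   ([tree_quasigeodesic_stable]), and [F1] distorts distances by at most [ln 2]
   ([exp_kernel_close], [schottky_turns]).
 - For [Rep k] with [k] large, finitely many words have almost the same length as for
   [Rep_oo].  By hyperbolicity, bounded turns on words of a fixed large size imply
   bounded turns on all words ([local_to_global]); lengths are then additive over
   blocks up to a bounded error per block, small relative to the length of a block
   ([lengths_comparable]).  The Gromov product of two orbit points being the
   length of the common prefix of the two words up to a constant
   ([gprod_common_prefix]), Gromov products are comparable too.
*)

Set Implicit Arguments.
Unset Strict Implicit.
Unset Printing Implicit Defensive.

Import Order.TTheory GRing.Theory Num.Theory.
Import numFieldNormedType.Exports.

Local Open Scope classical_set_scope.
Local Open Scope ring_scope.

(** * The hyperboloid is Gromov hyperbolic *)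

Section dot_product.
Variables (R : realType) (V : lmodType R) (dp : {dot V for idfun}).

Lemma dotC u v : dp u v = dp v u.
Proof. by rewrite hermitian_subproof expr0 mul1r. Qed.

Lemma dotDl u v w : dp (u + v) w = dp u w + dp v w.
Proof. exact: linearDl. Qed.

Lemma dotZl a u w : dp (a *: u) w = a * dp u w.
Proof. exact: linearZl_LR. Qed.

Lemma dotDr u v w : dp w (u + v) = dp w u + dp w v.
Proof. by rewrite dotC dotDl !(dotC w). Qed.

Lemma dotZr a u w : dp w (a *: u) = a * dp w u.
Proof. by rewrite dotC dotZl dotC. Qed.

Lemma dotNl u w : dp (- u) w = - dp u w.
Proof. by rewrite -scaleN1r dotZl mulN1r. Qed.

Lemma dotNr u w : dp w (- u) = - dp w u.
Proof. by rewrite dotC dotNl dotC. Qed.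

Lemma dot0l w : dp 0 w = 0.
Proof. by rewrite -(scale0r (0 : V)) dotZl mul0r. Qed.

Definition dotE := (dotDl, dotDr, dotNl, dotNr, dotZl, dotZr).

Lemma dot_ge0 u : 0 <= dp u u.
Proof.
have [->|u0] := eqVneq u 0; last by rewrite ltW// neq0_dnorm_gt0.
by rewrite dot0l.
Qed.

Lemma dot_eq0 u : dp u u = 0 -> u = 0.
Proof.
by move=> dp0; apply/eqP/negP => /negP /(neq0_dnorm_gt0 (s := dp)); rewrite dp0 ltxx.
Qed.

Lemma dot_CS u v : dp u v ^+ 2 <= dp u u * dp v v.
Proof.
have [->|v0] := eqVneq v 0; first by rewrite dotC !dot0l expr0n mulr0.
have vv : 0 < dp v v by apply: neq0_dnorm_gt0.
have := dot_ge0 (dp v v *: u - dp u v *: v).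
rewrite !dotE (dotC v u).
move=> h; have : 0 <= dp v v * (dp u u * dp v v - dp u v ^+ 2) by move: h; lra.
by rewrite pmulr_rge0// subr_ge0.
Qed.

Definition norm2 (u : V) : R := Num.sqrt (dp u u).

Lemma norm2_ge0 u : 0 <= norm2 u. Proof. exact: sqrtr_ge0. Qed.

Lemma norm2_sqr u : norm2 u ^+ 2 = dp u u.
Proof. by rewrite sqr_sqrtr// dot_ge0. Qed.

Lemma norm_dot_le u v : `|dp u v| <= norm2 u * norm2 v.
Proof.
rewrite -(@ler_pXn2r _ 2)// ?nnegrE ?mulr_ge0 ?norm2_ge0//.
by rewrite real_normK ?num_real// exprMn !norm2_sqr dot_CS.
Qed.

End dot_product.

Section lorentz_form.
Variables (R : realType) (V : lmodType R) (dp : {dot V for idfun}).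
Local Notation H := (hyperboloid dp).
Local Notation "<| p , q |>" := (lorentz dp p q).

Lemma lorentzC p q : <|p, q|> = <|q, p|>.
Proof. by rewrite /lorentz mulrC dotC. Qed.

Lemma lorentz_self (x : H) : <|\val x, \val x|> = 1.
Proof. by case: x => p /= /andP[_ /eqP]. Qed.

Lemma height_gt0 (x : H) : 0 < (\val x).1.
Proof. by case: x => p /= /andP[]. Qed.

(** Cauchy-Schwarz for the second components, with [|y.2|^2 = y.1^2 - 1]. *)
Lemma lorentz_perp_le0 (y : H) e : <|e, \val y|> = 0 -> <|e, e|> <= 0.
Proof.
case: y => -[y1 y2] /= /andP[/= y10 /eqP]; rewrite /lorentz/= => yy.
case: e => e1 e2 /= ey.
have CS := dot_CS dp e2 y2.
have ee0 := dot_ge0 dp e2.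
have ey' : e1 * y1 = dp e2 y2 by lra.
have yy' : dp y2 y2 = y1 ^+ 2 - 1 by rewrite expr2; lra.
have key : y1 ^+ 2 * (e1 * e1 - dp e2 e2) <= - dp e2 e2.
  have -> : y1 ^+ 2 * (e1 * e1 - dp e2 e2) = (e1 * y1) ^+ 2 - y1 ^+ 2 * dp e2 e2 by ring.
  by rewrite ey'; rewrite yy' in CS; lra.
have y20 : 0 < y1 ^+ 2 by rewrite exprn_gt0.
by rewrite -(pmulr_rle0 _ y20); lra.
Qed.

(** Dividing by [<x,o>], [<y,o>], [<z,o>] projects
    [x], [y], [z] on the affine hyperplane [<., o> = 1]; the second difference
    [x + z - 2 y] of the projections is orthogonal to [o], so its square is at most
    [0].  Taking logarithms gives the four-point condition of Gromov. *)
Lemma lorentz_four_point (o x y z : H) :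
  <|\val x, \val z|> * <|\val y, \val o|> <=
  2 * (<|\val x, \val y|> * <|\val z, \val o|> +
       <|\val y, \val z|> * <|\val x, \val o|>).
Proof.
have a1 := lorentz_ge1 x o; have b1 := lorentz_ge1 y o; have c1 := lorentz_ge1 z o.
set a := <|\val x, _|> in a1 *; set b := <|\val y, \val o|> in b1 *.
set c := <|\val z, \val o|> in c1 *.
pose e : R * V := (b * c * (\val x).1 + a * b * (\val z).1 - 2 * a * c * (\val y).1,
  (b * c) *: (\val x).2 + (a * b) *: (\val z).2 - (2 * a * c) *: (\val y).2).
have eE q : <|e, q|> = b * c * <|\val x, q|> + a * b * <|\val z, q|> -
    2 * a * c * <|\val y, q|>.
  by rewrite /lorentz /e/= !dotE; ring.
have eo : <|e, \val o|> = 0 by rewrite eE -/a -/b -/c; ring.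
have := lorentz_perp_le0 eo.
rewrite !eE !(lorentzC _ e) !eE !lorentz_self.
rewrite !(lorentzC (\val z) (\val x)) !(lorentzC (\val z) (\val y)).
rewrite !(lorentzC (\val y) (\val x)).
set xz := <|\val x, \val z|>; set xy := <|\val x, \val y|>.
set yz := <|\val y, \val z|>.
move=> h.
have h2 : (2 * a * b * c) * (xz * b - 2 * (xy * c + yz * a)) <=
    - (b ^+ 2 * c ^+ 2 + a ^+ 2 * b ^+ 2 + 4 * a ^+ 2 * c ^+ 2) by move: h; lra.
have h3 : 0 < 2 * a * b * c by rewrite !mulr_gt0//; lra.
rewrite -subr_le0 -(pmulr_rle0 _ h3) (le_trans h2)// oppr_le0.
by have := sqr_ge0 (b * c); have := sqr_ge0 (a * b); have := sqr_ge0 (a * c); lra.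
Qed.

End lorentz_form.

Definition gprod (R : realType) (X : metricType R) (o x y : X) : R :=
  (mdist o x + mdist o y - mdist x y) / 2.

Definition gromov_hyperbolic (R : realType) (X : metricType R) (delta : R) :=
  forall o x y z : X,
    Num.min (gprod o x y) (gprod o y z) - delta <= gprod o x z.

Section cosh_exp.
Variable R : realType.

Lemma cosh_le_expR (d : R) : 0 <= d -> cosh d <= expR d.
Proof.
move=> d0; have : expR (- d) <= expR d by rewrite ler_expR; lra.
by rewrite /cosh; lra.
Qed.

Lemma expR_le_cosh (d : R) : expR d <= 2 * cosh d.
Proof. by have := expR_ge0 (- d); rewrite /cosh; lra. Qed.

End cosh_exp.

Section hyperboloid_gromov.
Variables (R : realType) (V : lmodType R) (dp : {dot V for idfun}).
Local Notation H := (hyperboloid dp).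

Lemma expR_mdist_le (x y : H) : expR (mdist x y) <= 2 * lorentz dp (\val x) (\val y).
Proof. by rewrite -cosh_mdist expR_le_cosh. Qed.

Lemma lorentz_le_expR (x y : H) : lorentz dp (\val x) (\val y) <= expR (mdist x y).
Proof. by rewrite -cosh_mdist cosh_le_expR// mdist_ge0. Qed.

Lemma hyperboloid_hyperbolic : gromov_hyperbolic H (ln 16 / 2).
Proof.
move=> o x y z.
set p := mdist x y + mdist z o; set q := mdist y z + mdist x o.
suff h : mdist x z + mdist y o <= Num.max p q + ln 16.
  move: h; rewrite /gprod minEle maxEle /p /q.
  rewrite (metric_sym o x) (metric_sym o y) (metric_sym o z).
  by case: ifPn; rewrite -?ltNge => h1; case: ifPn; rewrite -?ltNge => h2 h; lra.
rewrite -ler_expR !expRD lnK ?posrE//.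
have le1 : expR (mdist x z) * expR (mdist y o) <=
    4 * (lorentz dp (\val x) (\val z) * lorentz dp (\val y) (\val o)).
  have -> (a b : R) : 4 * (a * b) = (2 * a) * (2 * b) by ring.
  by rewrite ler_pM ?expR_ge0// expR_mdist_le.
have le2 : lorentz dp (\val x) (\val y) * lorentz dp (\val z) (\val o) <= expR p.
  by rewrite expRD ler_pM ?lorentz_le_expR// (le_trans ler01)// lorentz_ge1.
have le3 : lorentz dp (\val y) (\val z) * lorentz dp (\val x) (\val o) <= expR q.
  by rewrite expRD ler_pM ?lorentz_le_expR// (le_trans ler01)// lorentz_ge1.
have le4 : expR p <= expR (Num.max p q) by rewrite ler_expR le_max lexx.
have le5 : expR q <= expR (Num.max p q) by rewrite ler_expR le_max lexx orbT.
by have := lorentz_four_point o x y z; lra.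
Qed.

End hyperboloid_gromov.

(** * Pointwise convergence of isometries on a total set *)

Section metric_convergence.
Variables (R : realType) (X : metricType R) (T : Type).
Variables (F : set_system T) (FF : Filter F).

Lemma cvg_mdistP (h : T -> X) (z : X) :
  (h k @[k --> F] --> z) <-> (mdist z (h k) @[k --> F] --> (0 : R)).
Proof.
split=> [/metricType_numDomainType.cvgrPdist_lt hz|].
  apply/cvgr0Pnorm_lt => e e0; have := hz e e0; apply: filterS => t.
  by rewrite ger0_norm// mdist_ge0.
move=> /cvgr0Pnorm_lt hz; apply/metricType_numDomainType.cvgrPdist_lt => e e0.
by have := hz e e0; apply: filterS => t; rewrite ger0_norm// mdist_ge0.
Qed.

End metric_convergence.

Lemma cosh_continuous (R : realType) : continuous (@cosh R).
Proof.
move=> u; rewrite /cosh; apply: cvgM; last exact: cvg_cst.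
apply: cvgD; first exact: continuous_expR.
by apply: continuous_cvg; [exact: continuous_expR|apply: cvgN; exact: cvg_id].
Qed.

Section isometries_converge.
Variables (R : realType) (V : lmodType R) (dp : {dot V for idfun}).
Local Notation H := (hyperboloid dp).
Local Notation "<| p , q |>" := (lorentz dp p q).
Variables (T : Type) (F : set_system T) (FF : Filter F).

Let origin_subproof : (0 < ((1 : R), (0 : V)).1) && (lorentz dp (1, 0) (1, 0) == 1).
Proof. by rewrite /lorentz/= dot0l mulr1 subr0 ltr01 eqxx. Qed.

Definition origin : H := exist _ (1, 0) origin_subproof.

Lemma lorentz_originr p : <|p, \val origin|> = p.1.
Proof. by rewrite /lorentz/= dotC dot0l mulr1 subr0. Qed.

Lemma height_cosh (x : H) : (\val x).1 = cosh (mdist x origin).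
Proof. by rewrite cosh_mdist lorentz_originr. Qed.

Lemma norm2_height (x : H) : norm2 dp (\val x).2 <= (\val x).1.
Proof.
rewrite -(@ler_pXn2r _ 2)// ?nnegrE ?norm2_ge0 ?(ltW (height_gt0 _))//.
by have := lorentz_self x; rewrite norm2_sqr /lorentz expr2; lra.
Qed.

Lemma lorentz_norm_le (x : H) q :
  `|<|\val x, q|>| <= (\val x).1 * (`|q.1| + norm2 dp q.2).
Proof.
rewrite /lorentz (le_trans (ler_normB _ _))// mulrDr lerD//.
  by rewrite normrM ger0_norm// ltW// height_gt0.
by rewrite (le_trans (norm_dot_le _ _ _))// ler_wpM2r ?norm2_ge0// norm2_height.
Qed.

Lemma cvg_hyperboloid (h : T -> H) (z : H) :
  <|\val z, \val (h k)|> @[k --> F] --> (1 : R) -> h k @[k --> F] --> z.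
Proof.
move=> hz; apply/cvg_mdistP.
suff : acosh (<|\val z, \val (h k)|>) @[k --> F] --> acosh (1 : R).
  by rewrite acosh1.
apply: (@continuous_cvg _ _ _ _ _ _ (@acosh R)) hz.
rewrite /acosh; apply: continuous_cvg.
  by apply: continuous_ln; rewrite expr1n subrr sqrtr0 addr0.
apply: cvgD; first exact: cvg_id.
apply: continuous_cvg; first exact: sqrt_continuous.
apply: cvgB; last exact: cvg_cst.
exact: exprn_continuous.
Qed.

(** The vectors [q] for which [<h k z, q>] converges to [<z, q>] form a linear
    subspace, closed because the points [h k z] stay bounded; it contains [A],
    since [<h k z, a>] is the [cosh] of a distance close to
    [mdist (h k z) (h k a) = mdist z a].  Totality puts [z] itself in this
    subspace, and [<h k z, z> --> 1] means [h k z --> z]. *)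
Lemma isom_cvg_id (h : T -> isom H) (A : set H) : total_set A ->
  (forall a, A a -> h k a @[k --> F] --> a) -> forall z, h k z @[k --> F] --> z.
Proof.
move=> totA hA z.
(* The trivial subspace is closed and misses the hyperboloid. *)
have [a0 Aa0] : exists a, A a.
  apply: contrapT => nA.
  have L0 : closed_linear_subspace dp [set (0, 0)].
    split=> [//|a _ _ -> ->/=|[p1 p2]]; first by rewrite mulr0 addr0 scaler0 addr0.
    move=> hp; have s0 : p1 ^+ 2 + dp p2 p2 <= 0.
      rewrite leNgt; apply/negP => /hp[q ->]/=.
      by rewrite !subr0 ltxx.
    have := sqr_ge0 p1; have := dot_ge0 dp p2 => d0 e0.
    have /eqP : p1 ^+ 2 = 0 by lra.
    rewrite sqrf_eq0 => /eqP ->; have /dot_eq0 -> // : dp p2 p2 = 0 by lra.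
  have T0 : [set x : H | [set (0, 0)] (\val x)] = setT.
    apply: totA; first by exists [set (0, 0)].
    by move=> x Ax; case: nA; exists x.
  have : [set x : H | [set (0, 0)] (\val x)] origin by rewrite T0.
  by move=> /(congr1 fst)/= /eqP; rewrite oner_eq0.
pose L := [set q : R * V | <|\val (h k z), q|> @[k --> F] --> <|\val z, q|>].
have bnd : exists2 C, 0 < C & \forall k \near F, (\val (h k z)).1 <= C.
  exists (expR (mdist z a0 + 1 + mdist a0 origin)); first exact: expR_gt0.
  have /metricType_numDomainType.cvgrPdist_lt /(_ 1 ltr01) := hA _ Aa0.
  apply: filterS => k hk; rewrite height_cosh.
  apply: le_trans (cosh_le_expR (mdist_ge0 _ _)) _; rewrite ler_expR.
  have := metric_triangle (h k z) (h k a0) origin.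
  have := metric_triangle (h k a0) a0 origin.
  rewrite isom_mdist (metric_sym (h k a0) a0); lra.
have cL : closed_linear_subspace dp L.
  split.
  - rewrite /L/= /lorentz/= !mulr0 dotC dot0l subr0.
    rewrite (_ : (fun k => _) = cst 0); first exact: cvg_cst.
    by apply/funext => k; rewrite mulr0 dotC dot0l subr0.
  - move=> a p q; rewrite /L/= => Lp Lq.
    have E v : <|v, (a * p.1 + q.1, a *: p.2 + q.2)|> = a * <|v, p|> + <|v, q|>.
      by rewrite /lorentz/= !dotE; ring.
    rewrite E; under eq_fun do rewrite E.
    by apply: cvgD => //; apply: cvgM => //; exact: cvg_cst.
  - move=> p hp; apply/cvgrPdist_le => e e0.
    have [C C0 hC] := bnd.
    pose D := Num.max C (\val z).1.
    have D0 : 0 < D by rewrite lt_max C0.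
    pose d := e / (6 * D).
    have d0 : 0 < d by rewrite divr_gt0// mulr_gt0.
    have [|q Lq pq] := hp (d ^+ 2); first by rewrite exprn_gt0.
    have pq1 : `|p.1 - q.1| <= d.
      rewrite -(@ler_pXn2r _ 2)// ?nnegrE// ?(ltW d0)// real_normK ?num_real//.
      by have := dot_ge0 dp (p.2 - q.2); lra.
    have pq2 : norm2 dp (p.2 - q.2) <= d.
      rewrite -(@ler_pXn2r _ 2)// ?nnegrE ?norm2_ge0// ?(ltW d0)// norm2_sqr.
      by have := sqr_ge0 (p.1 - q.1); lra.
    have close (x : H) : (\val x).1 <= D ->
        `|<|\val x, p|> - <|\val x, q|>| <= e / 3.
      move=> xD; have -> : <|\val x, p|> - <|\val x, q|> =
          <|\val x, (p.1 - q.1, p.2 - q.2)|> by rewrite /lorentz/= !dotE; ring.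
      apply: le_trans (lorentz_norm_le _ _) _ => /=.
      have -> : e / 3 = D * (d + d) by rewrite /d; field; rewrite gt_eqF.
      apply: ler_pM => //; rewrite ?(ltW (height_gt0 _))//.
        by rewrite addr_ge0// norm2_ge0.
      exact: lerD.
    have hq : \forall k \near F, `|<|\val z, q|> - <|\val (h k z), q|>| <= e / 3.
      by move/cvgrPdist_le : Lq; apply; rewrite divr_gt0.
    near=> k.
    have c1 : `|<|\val z, p|> - <|\val z, q|>| <= e / 3.
      by apply: close; rewrite le_max lexx orbT.
    have c2 : `|<|\val (h k z), p|> - <|\val (h k z), q|>| <= e / 3.
      by apply: close; rewrite le_max; apply/orP; left; near: k.
    have c3 : `|<|\val z, q|> - <|\val (h k z), q|>| <= e / 3 by near: k.
    by move: c1 c2 c3; rewrite !ler_norml; lra.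
have LA : A `<=` [set x : H | L (\val x)].
  move=> a Aa; rewrite /L/=.
  rewrite -cosh_mdist; under eq_fun do rewrite -cosh_mdist.
  apply: continuous_cvg; first exact: cosh_continuous.
  apply/cvgrPdist_le => e e0.
  have /metricType_numDomainType.cvgr_dist_le/(_ _ e0) := hA _ Aa.
  apply: filterS => k ae; rewrite -(isom_mdist (h k) z a).
  have := metric_triangle (h k z) (h k a) a.
  have := metric_triangle (h k z) a (h k a).
  by rewrite ler_norml (metric_sym (h k a) a); lra.
have LT : [set x : H | L (\val x)] = setT.
  by apply: (totA _ _ LA); exists L.
have : L (\val z) by have : [set x : H | L (\val x)] z by rewrite LT.
rewrite /L/= lorentz_self => Lz; apply: cvg_hyperboloid.
by under eq_fun do rewrite lorentzC.
Unshelve. all: by end_near. Qed.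

Lemma isom_cvg_total (h : T -> isom H) (g : isom H) (A : set H) : total_set A ->
  (forall a, A a -> h k a @[k --> F] --> g a) ->
  forall z, h k z @[k --> F] --> g z.
Proof.
move=> totA hA z.
have gV (y : H) : g ((g^-1)%g y) = y.
  by have /(congr1 (fun f : isom H => f y)) : (g * g^-1 = 1)%g by exact: mulgV.
have E y : (h k y @[k --> F] --> g y) <-> ((g^-1 * h k)%g y @[k --> F] --> y).
  split=> /cvg_mdistP hy; apply/cvg_mdistP; move: hy.
    under eq_fun do rewrite -(isom_mdist (g^-1)%g).
    by have -> : (g^-1)%g (g y) = y
      by have /(congr1 (fun f : isom H => f y)) : (g^-1 * g = 1)%g by exact: mulVg.
  under eq_fun do rewrite -(isom_mdist g).
  by under eq_fun do rewrite [X in mdist _ X]gV.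
by apply/E; apply: (isom_cvg_id totA) => a Aa; apply/E; exact: hA.
Qed.

End isometries_converge.

Lemma isom_eq_total (R : realType) (V : lmodType R) (dp : {dot V for idfun})
    (g h : isom (hyperboloid dp)) (A : set (hyperboloid dp)) :
  total_set A -> (forall a, A a -> g a = h a) -> g = h.
Proof.
move=> totA gh; apply: isom_eqP => z.
have gz : (fun=> g z) @ \oo --> h z.
  apply: (@isom_cvg_total _ _ _ nat \oo _ (fun=> g) h A totA) => a Aa.
  by rewrite gh//; exact: cvg_cst.
by apply: (cvg_unique _ _ gz); [exact: metric_hausdorff|exact: cvg_cst].
Qed.

(** * Quasi-geodesics in trees *)

Section tree_stability.
Variables (R : realType) (X : metricType R).

Lemma gprodC (o x y : X) : gprod o x y = gprod o y x.
Proof. by rewrite /gprod (metric_sym x) (addrC (mdist o x)). Qed.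

Lemma gprod_ge0 (o x y : X) : 0 <= gprod o x y.
Proof.
have := metric_triangle x o y; rewrite /gprod (metric_sym x o) => h.
by rewrite divr_ge0// subr_ge0.
Qed.

Lemma gprod_le_dist (o x y : X) : gprod o x y <= mdist o x.
Proof.
have := metric_triangle o x y; rewrite /gprod => h.
by rewrite ler_pdivrMr//; lra.
Qed.

Lemma gprod_near (o x y : X) : mdist o x - mdist x y <= gprod o x y.
Proof.
have := metric_triangle o y x; rewrite /gprod (metric_sym y x) => h.
by rewrite ler_pdivlMr//; lra.
Qed.

Lemma last_before (P : nat -> Prop) (i j : nat) : (i <= j)%N -> P i -> ~ P j ->
  exists a, [/\ (i <= a < j)%N, P a & ~ P a.+1].
Proof.
move=> /subnKC <-; elim: (j - i)%N => [|d IH] Pi; first by rewrite addn0.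
have [Pd|nPd] := pselect (P (i + d)%N) => nP.
  by exists (i + d)%N; rewrite leq_addr addnS ltnS leqnn -addnS.
by have [a [/andP[ia aj] Pa nPa]] := IH Pi nPd; exists a; rewrite ia addnS ltnS ltnW.
Qed.

(** Let [D0 = (y 0 | y n)] at [y i].  The path leaves the set of points whose
    product with [y 0] is at least [D0] by a step of length at most [M], hence at
    a point [y a] at distance at most [D0 + M] from [y i]; likewise on the
    other side at [y b].  In a tree [y a] and [y b] are then at distance at most
    [2 M], so [b - a] is bounded, and [y i] is close to [y a]. *)
Lemma tree_quasigeodesic_stable (y : nat -> X) (i n : nat) (M K : R) :
  gromov_hyperbolic X 0 -> 0 <= M -> 0 < K -> (i <= n)%N ->
  (forall j, (j < n)%N -> mdist (y j) (y j.+1) <= M) ->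
  (forall a c, (a <= c <= n)%N -> (c - a)%:R / K - K <= mdist (y a) (y c)) ->
  gprod (y i) (y 0%N) (y n) <= M * (K * (2 * M + K)).
Proof.
move=> hyp M0 K0 lein step lower; set D0 := gprod _ _ _.
have [D00|D00] := leP D0 0.
  by apply: le_trans D00 _; rewrite !(mulr_ge0, addr_ge0)// ltW.
have self o : gprod o o = fun=> 0.
  by apply/funext => z; rewrite /gprod mdistxx add0r subrr mul0r.
have selfr o z : gprod o z z = mdist o z by rewrite /gprod mdistxx; lra.
have step_near j z : (j < n)%N -> gprod (y i) (y j.+1) z < D0 ->
    D0 <= gprod (y i) (y j) z -> mdist (y i) (y j) <= D0 + M.
  move=> jn lt ge; have := hyp (y i) (y j.+1) (y j) z.
  have := gprod_near (y i) (y j) (y j.+1); have := step j jn.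
  rewrite (gprodC _ (y j.+1) (y j)).
  by rewrite minEle; case: ifPn; rewrite -?ltNge => *; lra.
have step_near' j z : (j < n)%N -> gprod (y i) (y j) z < D0 ->
    D0 <= gprod (y i) (y j.+1) z -> mdist (y i) (y j.+1) <= D0 + M.
  move=> jn lt ge; have := hyp (y i) (y j) (y j.+1) z.
  have := gprod_near (y i) (y j.+1) (y j); have := step j jn.
  rewrite (metric_sym (y j.+1)) (gprodC _ (y j.+1) (y j)).
  by rewrite minEle; case: ifPn; rewrite -?ltNge => *; lra.
have [||a [/andP[_ ai] Da nDa]] :=
    @last_before (fun j => D0 <= gprod (y i) (y j) (y 0%N)) 0 i isT.
- by rewrite selfr gprod_le_dist.
- by rewrite self; apply/negP; rewrite -ltNge.
have [||b [/andP[ib bn] Db nDb]] :=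
    @last_before (fun j => gprod (y i) (y j) (y n) < D0) i n lein.
- by rewrite self.
- by rewrite selfr; apply/negP; rewrite -leNgt /D0 gprodC gprod_le_dist.
move/negP: nDa; rewrite -ltNge => nDa; move/negP: nDb; rewrite -leNgt => nDb.
have da := step_near _ _ (leq_trans ai lein) nDa Da.
have db := step_near' _ _ bn Db nDb.
have Dab : D0 <= gprod (y i) (y a) (y b.+1).
  have := hyp (y i) (y a) (y 0%N) (y b.+1); have := hyp (y i) (y 0%N) (y n) (y b.+1).
  rewrite -/D0 (gprodC _ (y n)) subr0 subr0.
  by rewrite !minEle; case: ifPn; case: ifPn; rewrite -?ltNge => *; lra.
have dab : mdist (y a) (y b.+1) <= 2 * M by move: Dab; rewrite /gprod; lra.
have ab : (b.+1 - a)%:R <= K * (2 * M + K).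
  have abn : (a <= b.+1 <= n)%N by rewrite bn andbT (leq_trans (ltnW ai)) ?(leqW ib).
  have := lower _ _ abn; rewrite mulrC -ler_pdivrMl// mulrC; lra.
have ia : mdist (y i) (y a) <= M * (i - a)%:R.
  have : forall d, (a + d <= n)%N -> mdist (y (a + d)%N) (y a) <= M * d%:R.
    elim=> [|d IH] dn; first by rewrite addn0 mdistxx mulr0.
    have dn' : (a + d < n)%N by rewrite -addnS.
    have := metric_triangle (y (a + d).+1) (y (a + d)%N) (y a).
    have := step _ dn'; have := IH (ltnW dn').
    by rewrite addnS -natr1 mulrDr mulr1 (metric_sym (y (a + d).+1) (y (a + d)%N)) => *; lra.
  move/(_ (i - a)%N); rewrite subnKC ?(ltnW ai)//; exact.
apply: le_trans (le_trans Da (gprod_le_dist _ _ _)) (le_trans ia _).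
by apply: ler_wpM2l => //; apply: le_trans ab; rewrite ler_nat leq_sub2r// leqW.
Qed.

End tree_stability.

(** * Lengths of reduced words: from local to global *)

Section local_to_global.
Variables (R : realType) (A : Type) (good : seq A -> bool).
Hypothesis good_cat : forall u v, good (u ++ v) -> good u /\ good v.

(** Half the defect of additivity of a length; for the displacement length of an
    isometric action it is a Gromov product based at the junction of [u] and [v]. *)
Definition turn (L : seq A -> R) (u v : seq A) : R := (L u + L v - L (u ++ v)) / 2.

(** What [delta]-hyperbolicity of an isometric action says of displacement
    lengths at the quadruples of orbit points of [1], [u^-1], [b], [b v] and of
    [1], [a^-1], [(u a)^-1], [v]. *)
Definition hyperbolic_length (delta : R) (L : seq A -> R) : Prop :=
  [/\ forall u, 0 <= L u,
      forall u v, 0 <= turn L u v,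
      forall u b v, Num.min (turn L u (b ++ v)) (L b - turn L b v) - delta <=
        turn L u b &
      forall u a v, Num.min (L a - turn L u a) (turn L (u ++ a) v) - delta <=
        turn L a v].

(** First for short [u], by induction on [v]: if [b] is the prefix of [v] of size [m],
    then by induction the path through [v] moves away from the junction along [b]
    by nearly [L b], more than the claimed bound, so [v] may be replaced by [b] at the
    cost of [delta].  Then for all [u], by the same argument on the suffix of [u] of
    size [m]. *)
Lemma local_to_global (L : seq A -> R) (delta D Lm : R) (m : nat) :
  hyperbolic_length delta L -> 0 <= delta -> (0 < m)%N ->
  (forall u v, good (u ++ v) -> (size u <= m)%N -> (size v <= m)%N ->
    turn L u v <= D) ->
  (forall w, good w -> size w = m -> Lm <= L w) ->
  2 * D + 4 * delta < Lm ->
  forall u v, good (u ++ v) -> turn L u v <= D + 2 * delta.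
Proof.
move=> [_ _ H1 H2] d0 m0 short long LD.
have right : forall k u v, (size v <= k)%N -> good (u ++ v) -> (size u <= m)%N ->
    turn L u v <= D + delta.
  elim=> [|k IH] u v vk uv um.
    by have := short _ _ uv um (leq_trans vk (leq0n _)); lra.
  have [vm|mv] := leqP (size v) m; first by have := short _ _ uv um vm; lra.
  have sb : size (take m v) = m by rewrite size_takel// ltnW.
  have gub : good (u ++ take m v).
    by move: uv; rewrite -{1}(cat_take_drop m v) catA => /good_cat[].
  have gv : good (take m v ++ drop m v).
    by rewrite cat_take_drop; have [] := good_cat uv.
  have sd : (size (drop m v) <= k)%N.
    rewrite size_drop -ltnS (leq_trans _ vk)// ltn_subrL m0/=.
    exact: leq_trans m0 (ltnW mv).
  have t1 := IH _ _ sd gv (eq_leq sb).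
  have t2 := short _ _ gub um (eq_leq sb).
  have t3 := long _ (good_cat gv).1 sb.
  have := H1 u (take m v) (drop m v); rewrite cat_take_drop.
  by rewrite minEle; case: ifPn; rewrite -?ltNge => *; lra.
suff left : forall k u v, (size u <= k)%N -> good (u ++ v) ->
  turn L u v <= D + 2 * delta by move=> u v; exact: left.
elim=> [|k IH] u v uk uv.
  by have := right _ _ _ (leqnn _) uv (leq_trans uk (leq0n _)); lra.
have [um|mu] := leqP (size u) m.
  by have := right _ _ _ (leqnn _) uv um; lra.
pose i := (size u - m)%N.
have sa : size (drop i u) = m by rewrite size_drop subKn// ltnW.
have ga : good (drop i u ++ v).
  by move: uv; rewrite -{1}(cat_take_drop i u) -catA => /good_cat[].
have gu : good (take i u ++ drop i u).
  by rewrite cat_take_drop; have [] := good_cat uv.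
have si : (size (take i u) <= k)%N.
  rewrite size_takel ?leq_subr// -ltnS (leq_trans _ uk)// ltn_subrL m0/=.
  exact: leq_trans m0 (ltnW mu).
have t1 := IH _ _ si gu.
have t2 := right _ _ _ (leqnn _) ga (eq_leq sa).
have t3 := long _ (good_cat gu).2 sa.
have := H2 (take i u) (drop i u) v; rewrite cat_take_drop.
by rewrite minEle; case: ifPn; rewrite -?ltNge => *; lra.
Qed.

(** Cut a word into blocks of size [m]: either length is additive up to
    [2 D] at each junction, the two differ by at most [1] on each block, while the
    first length grows by at least [Lm - 2 D] per block. *)
Lemma lengths_comparable (L L' : seq A -> R) (D Lm e : R) (m : nat) :
  (forall u, 0 <= L u) ->
  (forall u v, good (u ++ v) -> 0 <= turn L u v <= D) ->
  (forall u v, good (u ++ v) -> 0 <= turn L' u v <= D) ->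
  (0 < m)%N -> 0 <= e ->
  (forall u, good u -> (size u <= m)%N -> `|L u - L' u| <= 1) ->
  (forall w, good w -> size w = m -> Lm <= L w) ->
  1 + 2 * D <= e * (Lm - 2 * D) ->
  forall w, good w -> `|L w - L' w| <= e * L w + 1.
Proof.
move=> L0 tL tL' m0 e0 short long eD.
suff main : forall k w, (size w <= k)%N -> good w -> `|L w - L' w| <= e * L w + 1.
  by move=> w; exact: main.
have small w : good w -> (size w <= m)%N -> `|L w - L' w| <= e * L w + 1.
  by move=> gw wm; apply: le_trans (short _ gw wm) _; rewrite lerDr mulr_ge0.
elim=> [|k IH] w wk gw; first by apply: small => //; apply: leq_trans wk _.
have [wm|mw] := leqP (size w) m; first exact: small.
have sb : size (take m w) = m by rewrite size_takel// ltnW.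
have gv : good (take m w ++ drop m w) by rewrite cat_take_drop.
have sd : (size (drop m w) <= k)%N.
  rewrite size_drop -ltnS (leq_trans _ wk)// ltn_subrL m0/=.
  exact: leq_trans m0 (ltnW mw).
have := tL _ _ gv; have := tL' _ _ gv; have := IH _ sd (good_cat gv).2.
have := short _ (good_cat gv).1 (eq_leq sb); have := long _ (good_cat gv).1 sb.
rewrite /turn cat_take_drop; set b := take m w; set w' := drop m w => h1 h2 h3 h4 h5.
have h6 : e * (Lm - 2 * D) <= e * (L w - L w') by apply: ler_wpM2l => //; lra.
move: h2 h3; rewrite !ler_norml; lra.
Qed.

End local_to_global.

Section words.
Variables (n : nat).
Local Notation letter := ('I_n * bool)%type.
Implicit Types (u v w : seq letter) (a : letter).

Definition inv_letter a : letter := (a.1, ~~ a.2).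

Definition inv_word w : seq letter := rev (map inv_letter w).

Lemma inv_letterK : involutive inv_letter.
Proof. by case=> i e; rewrite /inv_letter/= negbK. Qed.

Let compat : rel letter := [rel a c : letter | (a.1 == c.1) ==> (a.2 == c.2)].

Let compatE a c : compat a c = (a != inv_letter c).
Proof.
case: a c => [i e] [j e']; rewrite /compat /inv_letter/= xpair_eqE negb_and.
by case: eqP => //=; case: e; case: e'.
Qed.

Lemma reducedE w : reduced w = sorted (fun a c => a != inv_letter c) w.
Proof. by apply: eq_sorted => a c; rewrite -compatE. Qed.

Lemma reduced_cat u v : reduced (u ++ v) -> reduced u /\ reduced v.
Proof. by rewrite !reducedE => /cat_sorted2[-> ->]. Qed.

Lemma reduced_inv w : reduced w -> reduced (inv_word w).
Proof.
rewrite /reduced /inv_word rev_sorted sorted_map; apply: sub_sorted => a c /=.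
by rewrite eq_sym => /implyP h; apply/implyP => /h /eqP ->.
Qed.

Lemma reduced_inv_cat a c u v : a != c -> reduced (a :: u) -> reduced (c :: v) ->
  reduced (inv_word (a :: u) ++ c :: v).
Proof.
move=> ac /reduced_inv; rewrite !reducedE /inv_word map_cons rev_cons => au cv.
rewrite sorted_cat_cons; move: cv => /= ->; rewrite andbT.
move: au; rewrite /=; case: (rev _) => [|d s] /=.
  by rewrite andbT (inj_eq (can_inj inv_letterK)).
rewrite !rcons_path last_rcons => ->/=.
by rewrite (inj_eq (can_inj inv_letterK)).
Qed.

(** At the end of the longest common prefix the two words diverge without backtracking. *)
Lemma common_prefix w1 w2 : reduced w1 -> reduced w2 ->
  exists c u v, [/\ w1 = c ++ u, w2 = c ++ v & reduced (inv_word u ++ v)].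
Proof.
elim: w1 w2 => [|a w1 IH] w2 r1 r2; first by exists [::], [::], w2.
case: w2 r2 => [|c w2] r2.
  by exists [::], (a :: w1), [::]; split=> //; rewrite cats0; exact: reduced_inv.
have [ac|ac] := eqVneq a c; last first.
  by exists [::], (a :: w1), (c :: w2); split=> //; exact: reduced_inv_cat.
have [||p [u [v [-> -> uv]]]] := IH w2.
- by case: (@reduced_cat [:: a] w1 r1).
- by case: (@reduced_cat [:: c] w2 r2).
by exists (a :: p), u, v; rewrite ac.
Qed.

Variables (G : groupType) (b : 'I_n -> G).

Lemma word_val_cat u v : word_val b (u ++ v) = (word_val b u * word_val b v)%g.
Proof. by rewrite /word_val big_cat. Qed.

Lemma word_val_cons a u :
  word_val b (a :: u) = (word_val b [:: a] * word_val b u)%g.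
Proof. by rewrite -word_val_cat. Qed.

Lemma word_val_inv_letter a : word_val b [:: inv_letter a] = (word_val b [:: a])^-1%g.
Proof.
by rewrite /word_val !big_seq1 /inv_letter/=; case: a => i [] //=; rewrite invgK.
Qed.

Lemma word_val_inv u : word_val b (inv_word u) = (word_val b u)^-1%g.
Proof.
elim: u => [|a u IH]; first by rewrite /word_val !big_nil invg1.
rewrite /inv_word/= rev_cons -cats1 word_val_cat IH word_val_inv_letter.
by rewrite (word_val_cons a u) invgM.
Qed.

Lemma reduction v : exists w, [/\ reduced w, word_val b w = word_val b v &
  (size w <= size v)%N].
Proof.
elim: v => [|a v [w [rw wv sw]]]; first by exists [::].
case: w rw wv sw => [|c w] rw wv sw.
  by exists [:: a]; split=> //; rewrite (word_val_cons a v) -wv -word_val_cons.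
have [ac|ac] := eqVneq a (inv_letter c).
  exists w; split; first by case: (@reduced_cat [:: c] w rw).
    rewrite (word_val_cons a v) -wv (word_val_cons c) ac word_val_inv_letter.
    by rewrite mulKg.
  by rewrite (leq_trans _ (leqnSn _))// (leq_trans _ sw)/=.
exists (a :: c :: w); split => //; last by rewrite (word_val_cons a v) -wv -word_val_cons.
by move: rw; rewrite !reducedE/= => ->; rewrite ac.
Qed.

Hypothesis basis : free_basis b.

Lemma reduced_word g : exists2 w, reduced w & word_val b w = g.
Proof. by have [w [[rw wg] _]] := basis g; exists w. Qed.

Lemma word_length_reduced w : reduced w -> word_length b (word_val b w) = size w.
Proof.
move=> rw.
have minw v : word_val b v = word_val b w -> (size w <= size v)%N.
  have [v' [rv' vv' sv]] := reduction v => vw.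
  have [w0 [_ uniq]] := basis (word_val b w).
  by rewrite -(uniq w)// (uniq v')// vv'.
rewrite /word_length; case: xgetP => [m ->|/(_ (size w))[]]; last by split=> //; exists w.
by move=> [[v vm vw] mmin]; apply/eqP; rewrite eqn_leq mmin//= -vm minw.
Qed.

End words.

(** * Gromov products of orbits of a free group *)

Section displacement_lengths.
Variables (R : realType) (X : metricType R) (G : groupType) (n : nat).
Variables (b : 'I_n -> G) (rho : G -> isom X) (p : X).
Hypothesis rhoM : forall g h, rho (g * h)%g = (rho g * rho h)%g.

Definition orbit_length (w : seq ('I_n * bool)) : R := mdist p (rho (word_val b w) p).

Lemma action1 : rho 1%g = 1%g.
Proof. by apply: (mulgI (rho 1%g)); rewrite -rhoM !mulg1. Qed.

Lemma orbit_dist g h : mdist (rho g p) (rho h p) = mdist p (rho (g^-1 * h)%g p).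
Proof.
rewrite rhoM -[RHS](isom_mdist (rho g)).
have -> : rho g ((rho g^-1%g * rho h)%g p) = (rho g * (rho g^-1%g * rho h))%g p by [].
by rewrite mulgA -rhoM mulgV action1 mul1g.
Qed.

Lemma orbit_lengthV g : mdist p (rho g^-1%g p) = mdist p (rho g p).
Proof.
have := orbit_dist g 1%g; rewrite mulg1 action1 => <-.
by rewrite metric_sym.
Qed.

Lemma orbit_length_inv w : orbit_length (inv_word w) = orbit_length w.
Proof. by rewrite /orbit_length word_val_inv orbit_lengthV. Qed.

Lemma turn_gprod u v : turn orbit_length u v =
  gprod p (rho (word_val b u)^-1%g p) (rho (word_val b v) p).
Proof.
by rewrite /turn /gprod orbit_lengthV orbit_dist invgK -word_val_cat.
Qed.

Lemma turn_orbit_length_ge0 u v : 0 <= turn orbit_length u v.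
Proof. by rewrite turn_gprod gprod_ge0. Qed.

Lemma hyperbolic_orbit_length delta :
  gromov_hyperbolic X delta -> hyperbolic_length delta orbit_length.
Proof.
move=> hyp; split=> [u|u v|u c v|u a v]; first exact: mdist_ge0.
- exact: turn_orbit_length_ge0.
- have := hyp p (rho (word_val b u)^-1%g p) (rho (word_val b (c ++ v)) p)
    (rho (word_val b c) p).
  rewrite -!turn_gprod (_ : gprod _ (rho (word_val b (c ++ v)) p) _ =
    orbit_length c - turn orbit_length c v)//.
  rewrite gprodC /gprod orbit_dist word_val_cat mulKg -word_val_cat.
  by rewrite /turn /orbit_length; lra.
- have := hyp p (rho (word_val b a)^-1%g p) (rho (word_val b (u ++ a))^-1%g p)
    (rho (word_val b v) p).
  rewrite -!turn_gprod (_ : gprod _ _ (rho (word_val b (u ++ a))^-1%g p) =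
    orbit_length a - turn orbit_length u a)//.
  rewrite /gprod orbit_dist !orbit_lengthV invgK word_val_cat invgM mulgA mulgV mul1g.
  by rewrite orbit_lengthV -word_val_cat /turn /orbit_length; lra.
Qed.

(** When turns are bounded, the orbit paths of [u] and [v] diverge at once after their
    common prefix [c], so that the Gromov product is the length of [c] up to an
    additive constant. *)
Lemma gprod_common_prefix D c u v :
  (forall u v, reduced (u ++ v) -> turn orbit_length u v <= D) ->
  reduced (c ++ u) -> reduced (c ++ v) -> reduced (inv_word u ++ v) ->
  orbit_length c - 2 * D <=
    gprod p (rho (word_val b (c ++ u)) p) (rho (word_val b (c ++ v)) p) <=
  orbit_length c + D.
Proof.
move=> hD cu cv uv.
have t1 := hD _ _ cu; have t2 := hD _ _ cv; have t3 := hD _ _ uv.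
have s1 := turn_orbit_length_ge0 c u; have s2 := turn_orbit_length_ge0 c v.
have s3 := turn_orbit_length_ge0 (inv_word u) v.
have E : mdist (rho (word_val b (c ++ u)) p) (rho (word_val b (c ++ v)) p) =
    orbit_length (inv_word u ++ v).
  rewrite orbit_dist /orbit_length !word_val_cat word_val_inv invgM.
  by rewrite -mulgA mulKg.
move: t1 t2 t3 s1 s2 s3; rewrite /gprod E /turn orbit_length_inv.
rewrite -![mdist p _]/(orbit_length _) => *; apply/andP; split; lra.
Qed.

End displacement_lengths.

Section gromov_product_stability.
Variables (R : realType) (G : groupType) (n : nat) (b : 'I_n -> G).
Hypothesis basis : free_basis b.

Definition orbit_gprod (X : metricType R) (rho : G -> isom X) (p : X) (g h : G) : R :=
  gprod p (rho g p) (rho h p).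

(** Both products are close to the length of one and the same common prefix, so a
    comparison of lengths is enough. *)
Lemma orbit_gprod_comparable (X X' : metricType R) (rho : G -> isom X)
    (rho' : G -> isom X') (p : X) (p' : X') (D e : R) :
  (forall g h, rho (g * h)%g = (rho g * rho h)%g) ->
  (forall g h, rho' (g * h)%g = (rho' g * rho' h)%g) ->
  (forall u v, reduced (u ++ v) -> turn (orbit_length b rho p) u v <= D) ->
  (forall u v, reduced (u ++ v) -> turn (orbit_length b rho' p') u v <= D) ->
  0 <= e <= 1 ->
  (forall w, reduced w -> `|orbit_length b rho p w - orbit_length b rho' p' w| <=
     e * orbit_length b rho p w + 1) ->
  forall g h,
    (1 - e) * orbit_gprod rho p g h - (3 * D + 1) <= orbit_gprod rho' p' g h /\
    (1 - e) * orbit_gprod rho' p' g h - (3 * D + 1) <= orbit_gprod rho p g h.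
Proof.
move=> rhoM rhoM' tD tD' /andP[e0 e1] close g h.
have [w1 r1 <-] := reduced_word basis g; have [w2 r2 <-] := reduced_word basis h.
have [c [u [v [E1 E2 uv]]]] := common_prefix r1 r2.
rewrite E1 in r1 *; rewrite E2 in r2 *.
have /andP[a1 a2] := gprod_common_prefix rhoM tD r1 r2 uv.
have /andP[b1 b2] := gprod_common_prefix rhoM' tD' r1 r2 uv.
have := close _ (reduced_cat r1).1.
have D0 : 0 <= D by apply: le_trans (tD _ _ r1); exact: turn_orbit_length_ge0.
have : 0 <= orbit_length b rho p c by exact: mdist_ge0.
move: a1 a2 b1 b2; rewrite /orbit_gprod.
set A := gprod _ _ _; set B := gprod _ _ _.
set l := orbit_length b rho p c; set l' := orbit_length b rho' p' c.
move=> a1 a2 b1 b2 l0; rewrite ler_norml => /andP[c1 c2].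
have eD : 0 <= e * D by rewrite mulr_ge0.
have f : 0 <= 1 - e by lra.
split.
  have : (1 - e) * A <= (1 - e) * (l + D) by rewrite ler_wpM2l.
  lra.
have : (1 - e) * B <= (1 - e) * (l' + D) by rewrite ler_wpM2l.
have : (1 - e) * l' <= (1 - e) * ((1 + e) * l + 1) by rewrite ler_wpM2l//; lra.
have : 0 <= e * e * l by rewrite !mulr_ge0.
lra.
Qed.

Lemma near_short_words (T : Type) (F : set_system T) (FF : Filter F)
    (P : seq ('I_n * bool) -> T -> Prop) (m : nat) :
  (forall w, \forall k \near F, P w k) ->
  \forall k \near F, forall w, (size w <= m)%N -> P w k.
Proof.
move=> hP; pose I := {i : 'I_m.+1 & i.-tuple ('I_n * bool)%type}.
have : \forall k \near F, forall i : I, P (tagged i) k by exact: filter_forall.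
apply: filterS => k hk w wm.
pose i : 'I_m.+1 := Ordinal (wm : (size w < m.+1)%N).
by have := hk (Tagged (fun i : 'I_m.+1 => i.-tuple _) (@Tuple i _ w (eqxx _))).
Qed.

(** The finitely many words of length at most [2 m] decide everything: for [k] large
    they have almost the same length under [rho k] and [rho_oo], so
    [local_to_global] bounds the turns of [rho k] on all words, and then all
    lengths, hence all Gromov products, are comparable. *)
Lemma orbit_gprod_stable (X : metricType R) (T : Type) (F : set_system T)
    (FF : Filter F) (rho : T -> G -> isom X) (rho_oo : G -> isom X) (p : X)
    (delta D : R) :
  gromov_hyperbolic X delta -> 0 <= delta ->
  (\forall k \near F, forall g h, rho k (g * h)%g = (rho k g * rho k h)%g) ->
  (forall g h, rho_oo (g * h)%g = (rho_oo g * rho_oo h)%g) ->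
  (forall g, rho k g p @[k --> F] --> rho_oo g p) ->
  (forall u v, reduced (u ++ v) -> turn (orbit_length b rho_oo p) u v <= D) ->
  (forall C, exists2 m, (0 < m)%N & forall w, reduced w -> size w = m ->
    C <= orbit_length b rho_oo p w) ->
  forall e : R, 0 < e < 1 -> exists C, \forall k \near F, forall g h,
    (1 - e) * orbit_gprod rho_oo p g h - C <= orbit_gprod (rho k) p g h /\
    (1 - e) * orbit_gprod (rho k) p g h - C <= orbit_gprod rho_oo p g h.
Proof.
move=> hyp d0 nearM rhoM cvg_rho tD grow e /andP[e0 e1].
pose D2 := D + 1 + 2 * delta.
have D0 : 0 <= D by apply: le_trans (tD [::] [::] isT); exact: turn_orbit_length_ge0.
have [m m0 long] := grow ((1 + 2 * D2) / e + 2 * D2 + 2 * (D + 1) + 4 * delta + 2).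
have q0 : 0 <= (1 + 2 * D2) / e by rewrite divr_ge0 ?(ltW e0)// /D2; lra.
have len_cvg w : \forall k \near F,
    `|orbit_length b rho_oo p w - orbit_length b (rho k) p w| <= 1 / 2.
  have := cvg_rho (word_val b w).
  have half : 0 < 1 / 2 :> R by lra.
  move=> /metricType_numDomainType.cvgr_dist_le/(_ _ half).
  apply: filterS => k; rewrite /orbit_length.
  set x := rho_oo _ p; set y := rho k _ p => xy.
  have := metric_triangle p x y; have := metric_triangle p y x.
  by rewrite (metric_sym y) ler_norml => *; apply/andP; split; lra.
exists (3 * D2 + 1).
near=> k.
have kM : forall g h, rho k (g * h)%g = (rho k g * rho k h)%g by near: k.
have short : forall w, (size w <= m + m)%N ->
    `|orbit_length b rho_oo p w - orbit_length b (rho k) p w| <= 1 / 2.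
  by near: k; exact: near_short_words.
have tk : forall u v, reduced (u ++ v) -> turn (orbit_length b (rho k) p) u v <= D2.
  rewrite /D2; apply: (local_to_global (@reduced_cat n) (L := orbit_length b (rho k) p)
    (Lm := 2 * (D + 1) + 4 * delta + 1) (m := m)) => //.
  - exact: hyperbolic_orbit_length.
  - move=> u v uv um vm; have := tD _ _ uv.
    have := short (u ++ v); rewrite size_cat => /(_ (leq_add um vm)).
    have := short _ (leq_trans um (leq_addr m m)).
    have := short _ (leq_trans vm (leq_addr m m)).
    rewrite /turn !ler_norml => *; lra.
  - move=> w rw wm; have := long w rw wm; have := short w.
    rewrite {1}wm leq_addr ler_norml => /(_ isT) *.
    have D20 : 0 <= D2 by rewrite /D2; lra.
    lra.
  - lra.
have tD2 : forall u v, reduced (u ++ v) -> turn (orbit_length b rho_oo p) u v <= D2.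
  by move=> u v uv; have := tD _ _ uv; rewrite /D2; lra.
apply: orbit_gprod_comparable => //; first by rewrite !ltW.
apply: (lengths_comparable (@reduced_cat n) (D := D2) (m := m)
  (Lm := (1 + 2 * D2) / e + 2 * D2 + 2 * (D + 1) + 4 * delta + 2)) => //.
- by move=> u; exact: mdist_ge0.
- by move=> u v uv; rewrite turn_orbit_length_ge0//= tD2.
- by move=> u v uv; rewrite turn_orbit_length_ge0//= tk.
- exact: ltW.
- move=> u _ um; apply: le_trans (short _ (leq_trans um (leq_addr m m))) _; lra.
- have : e * ((1 + 2 * D2) / e) = 1 + 2 * D2 by rewrite mulrC divfK// gt_eqF.
  have : 0 <= e * (2 * (D + 1) + 4 * delta + 2) by rewrite mulr_ge0 ?(ltW e0)//; lra.
  lra.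
Unshelve. all: by end_near. Qed.

End gromov_product_stability.

(** * Orbits on the limit tree *)

Section asymptotic_cone_tree.
Variables (R : realType) (X : metricType R) (r : nat -> {nonneg R}) (o : nat -> X).
Variables (omega : set_system nat) (Uomega : UltraFilter omega).
Local Notation cone := (asymptotic_cone r o Uomega).

Let ufilter : ProperFilter omega := @ultra_proper _ _ Uomega.
Local Existing Instance ufilter.

Lemma nonprincipal_cofinite : (forall n, ~ omega [set n]) -> \oo `<=` omega.
Proof.
move=> np A [N _ NA]; suff : omega [set k | (N <= k)%N] by apply: filterS.
elim: N {NA} => [|N IH]; first by apply: filterS filterT.
have [/np//|nN] := in_ultra_setVsetC [set N] Uomega.
apply: filterS (filterI IH nN) => k [/= Nk kN].
by rewrite ltn_neqAle Nk andbT; apply/eqP => E; apply: kN.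
Qed.

Lemma cone_mdist_cvg (p q : cone) :
  rescaled_dist r (\val (repr p)) (\val (repr q)) @ omega --> mdist p q.
Proof.
have classK (s : cone) : cone_class r o Uomega (\val (repr s)) = s.
  by rewrite /cone_class valKd reprK.
have fin (s : cone) : finite_distance r o omega (\val (repr s)) := valP (repr s).
by rewrite -{2}(classK p) -{2}(classK q); exact: cone_mdist_class.
Qed.

(** The hyperbolicity constant is divided by [r k], so it vanishes in the limit. *)
Lemma cone_zero_hyperbolic (delta : R) : gromov_hyperbolic X delta ->
  (r k)%:num @[k --> omega] --> +oo -> gromov_hyperbolic cone 0.
Proof.
move=> hyp rinf p x y z.
pose s (q : cone) := \val (repr q).
pose g (u v : cone) k := (rescaled_dist r (s p) (s u) k +
  rescaled_dist r (s p) (s v) k - rescaled_dist r (s u) (s v) k) / 2.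
have g_cvg u v : g u v @ omega --> gprod p u v.
  apply: cvgM; last exact: cvg_cst.
  by apply: cvgB; [apply: cvgD|]; exact: cone_mdist_cvg.
have gE u v k : g u v k = gprod (s p k) (s u k) (s v k) / (r k)%:num.
  by rewrite /g /gprod /rescaled_dist; ring.
have err : (fun k => delta / (r k)%:num) @ omega --> (0 : R).
  rewrite -(mulr0 delta); apply: cvgM; first exact: cvg_cst.
  apply/cvgr0Pnorm_lt => e e0.
  have /cvgryPgt /(_ e^-1) := rinf.
  apply: filterS => k ek; rewrite ger0_norm ?invr_ge0//.
  by rewrite invf_plt// posrE (lt_trans _ ek)// invr_gt0.
have near_le u v : (\forall k \near omega, g u v k - delta / (r k)%:num <= g x z k) ->
    gprod p u v <= gprod p x z.
  move=> h; apply: ler_cvg_to h; last exact: g_cvg.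
  by rewrite -[X in _ --> X]subr0; apply: cvgB.
have scaled k : Num.min (g x y k) (g y z k) - delta / (r k)%:num <= g x z k.
  have := hyp (s p k) (s x k) (s y k) (s z k); rewrite !gE => h.
  have i0 : 0 <= (r k)%:num^-1 by rewrite invr_ge0.
  apply: le_trans (ler_wpM2r i0 h).
  by rewrite mulrBl minr_pMl.
rewrite subr0.
have [le|gt] := in_ultra_setVsetC [set k | g x y k <= g y z k] Uomega.
  rewrite ge_min; apply/orP; left; apply: near_le; apply: filterS le => k /= le.
  by have := scaled k; rewrite min_l.
rewrite ge_min; apply/orP; right; apply: near_le; apply: filterS gt => k /= /negP.
by rewrite -ltNge => gt; have := scaled k; rewrite min_r// ltW.
Qed.

End asymptotic_cone_tree.

Section tree_orbits.
Variables (R : realType) (T X : metricType R) (G : groupType) (n : nat).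
Variables (b : 'I_n -> G) (basis : free_basis b).
Variables (rhoT : G -> isom T) (rho : G -> isom X).
Hypothesis rhoTM : forall g h, rhoT (g * h)%g = (rhoT g * rhoT h)%g.
Hypothesis rhoM : forall g h, rho (g * h)%g = (rho g * rho h)%g.
Variables (F : T -> X) (c : R).
Hypothesis F_equiv : forall g x, F (rhoT g x) = rho g (F x).
Hypothesis F_close : forall x y,
  mdist x y <= mdist (F x) (F y) <= mdist x y + c.

(** The orbit in [T] is a quasi-geodesic image of each reduced word, so
    [tree_quasigeodesic_stable] bounds its turns; [F] and a change of base point
    alter lengths by a bounded amount only. *)
Lemma schottky_turns (x0 : T) (p : X) :
  gromov_hyperbolic T 0 -> schottky b rho ->
  (exists D, forall u v, reduced (u ++ v) -> turn (orbit_length b rho p) u v <= D) /\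
  (forall C, exists2 m, (0 < m)%N & forall w, reduced w -> size w = m ->
    C <= orbit_length b rho p w).
Proof.
move=> hyp [K [x1 [K1 QI]]].
have c0 : 0 <= c by have := F_close x0 x0; rewrite !mdistxx add0r => /andP[].
have move_base g (q q' : X) :
    `|mdist q (rho g q) - mdist q' (rho g q')| <= 2 * mdist q q'.
  have := metric_triangle q q' (rho g q); have := metric_triangle q' (rho g q') (rho g q).
  have := metric_triangle q' q (rho g q'); have := metric_triangle q (rho g q) (rho g q').
  rewrite !isom_mdist (metric_sym q' q) ler_norml => *; lra.
have LT g : mdist x0 (rhoT g x0) <= mdist (F x0) (rho g (F x0)) <=
    mdist x0 (rhoT g x0) + c by rewrite -F_equiv.
pose K' := K + 2 * mdist x1 (F x0) + c.
have K'0 : 0 < K' by rewrite /K'; have := mdist_ge0 x1 (F x0); lra.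
have lowT w : reduced w -> (size w)%:R / K' - K' <= orbit_length b rhoT x0 w.
  move=> rw; have := QI 1%g (word_val b w); rewrite invg1 mul1g word_length_reduced//.
  rewrite (action1 rhoM) => -[low _]; rewrite /orbit_length.
  have : (size w)%:R / K' <= K^-1 * (size w)%:R.
    rewrite mulrC ler_wpM2r// lef_pV2 ?posrE//; last lra.
    by rewrite /K'; have := mdist_ge0 x1 (F x0); lra.
  have /andP[_] := LT (word_val b w); have := move_base (word_val b w) x1 (F x0).
  by move: low; rewrite -[(1%g : isom X) x1]/x1 ler_norml /K'; lra.
pose M := \sum_(a : 'I_n * bool) mdist x0 (rhoT (word_val b [:: a]) x0).
have letter_le a : mdist x0 (rhoT (word_val b [:: a]) x0) <= M.
  rewrite /M (bigD1 a)//= lerDl sumr_ge0// => *; exact: mdist_ge0.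
have M0 : 0 <= M by apply: sumr_ge0 => *; exact: mdist_ge0.
pose DT := M * (K' * (2 * M + K')).
have turnT u v : reduced (u ++ v) -> turn (orbit_length b rhoT x0) u v <= DT.
  move=> uv; pose w := u ++ v; pose y j := rhoT (word_val b (take j w)) x0.
  have ydist i j : (i <= j <= size w)%N ->
      mdist (y i) (y j) = orbit_length b rhoT x0 (drop i (take j w)).
    move=> /andP[ij jw]; rewrite /y orbit_dist//; congr mdist.
    rewrite -{1}(cat_take_drop i (take j w)) take_takel// word_val_cat mulKg.
    by [].
  have := @tree_quasigeodesic_stable _ _ y (size u) (size w) M K' hyp M0 K'0.
  have -> : gprod (y (size u)) (y 0%N) (y (size w)) = turn (orbit_length b rhoT x0) u v.
    rewrite /gprod (metric_sym (y (size u)) (y 0%N)).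
    have uw : (size u <= size w)%N by rewrite size_cat leq_addr.
    rewrite !ydist ?leq0n ?leqnn ?uw//.
    by rewrite !drop0 take_size take_size_cat// drop_size_cat.
  apply.
  - by rewrite size_cat leq_addr.
  - move=> j jw; rewrite ydist ?leqnSn//.
    have a0 : 'I_n * bool by move: jw; case: (w) => // a ? _; exact: a.
    rewrite (take_nth a0)// -cats1 drop_size_cat ?size_takel ?(ltnW jw)//.
    exact: letter_le.
  - move=> i j ij; rewrite ydist//; have /andP[le lew] := ij.
    have := lowT (drop i (take j w)).
    rewrite size_drop size_takel//; apply.
    have : reduced (take j w).
      by apply: (reduced_cat (v := drop j w) _).1; rewrite cat_take_drop.
    by rewrite -{1}(cat_take_drop i (take j w)) => /reduced_cat[_].
pose c' := 2 * mdist p (F x0) + c.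
have lenX w : orbit_length b rhoT x0 w - c' <= orbit_length b rho p w <=
    orbit_length b rhoT x0 w + c'.
  have := move_base (word_val b w) p (F x0); have := LT (word_val b w).
  by rewrite ler_norml /orbit_length /c' => /andP[? ?] /andP[? ?]; apply/andP; split; lra.
split.
  exists (DT + 3 * c') => u v uv; have := turnT _ _ uv; rewrite /turn.
  have := mdist_ge0 p (F x0); have := lenX u; have := lenX v; have := lenX (u ++ v).
  move=> /andP[? ?] /andP[? ?] /andP[? ?] *; have : 0 <= c' by rewrite /c'; lra.
  lra.
move=> C; exists (Num.truncn (`|K' * (C + c' + K')|)).+1 => // w rw wm.
have /andP[+ _] := lenX w; have := lowT w rw.
have : C + c' + K' <= (size w)%:R / K'.
  rewrite ler_pdivlMr// mulrC (le_trans (ler_norm _))// wm ltW//.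
  exact: truncnS_gt.
lra.
Qed.

End tree_orbits.

Section exponential_kernel.
Variables (R : realType).

Lemma exp_kernel_close (T : metricType R) (F : T -> hyperbolic_space_oo R) :
  has_kernel (@exp_dist R T) F ->
  forall x y, mdist x y <= mdist (F x) (F y) <= mdist x y + ln 2.
Proof.
move=> hF x y; have E := hF x y; rewrite /exp_dist in E.
rewrite -ler_expR -E cosh_le_expR ?mdist_ge0//=.
by rewrite -ler_expR expRD lnK ?posrE// -E mulrC expR_le_cosh.
Qed.

End exponential_kernel.

(** * Gromov products in Klein coordinates *)

Section strong_convergence.
Variables (R : realType) (V : lmodType R) (dp : {dot V for idfun}).
Variables (T : Type) (F : set_system T) (FF : Filter F).

Definition strong_cvg (u : T -> V) (xi : V) : Prop :=
  norm2 dp (u t - xi) @[t --> F] --> (0 : R).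

Lemma strong_cvg_cst w : strong_cvg (fun=> w) w.
Proof.
rewrite /strong_cvg; under eq_fun do rewrite subrr /norm2 dot0l sqrtr0.
exact: cvg_cst.
Qed.

Lemma cvg_dot (u v : T -> V) (xi zeta : V) :
  strong_cvg u xi -> strong_cvg v zeta ->
  dp (u t) (v t) @[t --> F] --> (dp xi zeta : R).
Proof.
move=> ux vz.
pose err t := norm2 dp (u t - xi) * norm2 dp (v t - zeta) +
  norm2 dp (u t - xi) * norm2 dp zeta + norm2 dp xi * norm2 dp (v t - zeta).
have err0 : err @ F --> (0 : R).
  rewrite -[X in _ --> X]addr0; apply: cvgD.
    rewrite -[X in _ --> X]addr0; apply: cvgD.
      by rewrite -[X in _ --> X](mulr0 0); apply: cvgM.
    by rewrite -[X in _ --> X](mul0r (norm2 dp zeta)); apply: cvgM => //; exact: cvg_cst.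
  by rewrite -[X in _ --> X](mulr0 (norm2 dp xi)); apply: cvgM => //; exact: cvg_cst.
apply: (squeeze_cvgr (f := fun t => dp xi zeta - err t)
  (h := fun t => dp xi zeta + err t)).
- apply: nearW => t.
  have := norm_dot_le dp (u t - xi) (v t - zeta).
  have := norm_dot_le dp (u t - xi) zeta; have := norm_dot_le dp xi (v t - zeta).
  rewrite /err !dotE !ler_norml => /andP[? ?] /andP[? ?] /andP[? ?].
  by apply/andP; split; lra.
- by rewrite -[X in _ --> X]subr0; apply: cvgB => //; exact: cvg_cst.
- by rewrite -[X in _ --> X]addr0; apply: cvgD => //; exact: cvg_cst.
Qed.

End strong_convergence.

Section horospherical.
Variables (R : realType) (V : lmodType R) (dp : {dot V for idfun}).
Local Notation H := (hyperboloid dp).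
Local Notation "<| p , q |>" := (lorentz dp p q).

(** The product [<p, (1, u)>]; for a unit vector [u], its logarithm is the Busemann
    function of the boundary point [u], normalized at the origin. *)
Definition horo (p : H) (u : V) : R := (\val p).1 - dp (\val p).2 u.

(** At Klein coordinates of points [x] and [y] this is
    [<x, y> / (<p, x> <p, y>)], that is [exp (- 2 (x|y)_p)] up to a bounded factor
    (see [chord_gprod]); at boundary points it is exactly twice the square of the
    visual distance (see [visual_distE]).  Being a formula in [u] and [v], it carries
    estimates on orbits over to limit sets. *)
Definition chord (p : H) (u v : V) : R := (1 - dp u v) / (horo p u * horo p v).

(** The lower bound comes from [p.1 - |p.2| = (p.1 + |p.2|)^-1]. *)
Lemma horo_bounds (p : H) u : dp u u <= 1 ->
  (2 * (\val p).1)^-1 <= horo p u <= 2 * (\val p).1.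
Proof.
move=> u1; have p0 := height_gt0 p; have np := norm2_height p.
have n0 := norm2_ge0 dp (\val p).2.
have nu : norm2 dp u <= 1.
  by rewrite -(@ler_pXn2r _ 2)// ?nnegrE ?norm2_ge0// norm2_sqr expr1n.
have : `|dp (\val p).2 u| <= norm2 dp (\val p).2.
  by rewrite (le_trans (norm_dot_le _ _ _))// -[leRHS]mulr1 ler_wpM2l.
rewrite ler_norml /horo => /andP[h1 h2]; apply/andP; split; last by lra.
have pp : (\val p).1 ^+ 2 - norm2 dp (\val p).2 ^+ 2 = 1.
  by have := lorentz_self p; rewrite /lorentz norm2_sqr expr2.
apply: (@le_trans _ _ ((\val p).1 - norm2 dp (\val p).2)); last lra.
rewrite -div1r ler_pdivrMr ?mulr_gt0//.
move: pp p0 np n0; set a := (\val p).1; set c := norm2 _ _ => pp p0 np n0.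
have : 0 <= (a - c) * (a - c) by rewrite mulr_ge0//; lra.
by move: pp; rewrite !expr2; lra.
Qed.

Lemma horo_gt0 (p : H) u : dp u u <= 1 -> 0 < horo p u.
Proof.
move=> /(horo_bounds p)/andP[h _]; apply: lt_le_trans h.
by rewrite invr_gt0 mulr_gt0// height_gt0.
Qed.

Lemma klein_height (x : H) : (\val x).2 = (\val x).1 *: klein x.
Proof. by rewrite /klein scalerA divff ?scale1r// gt_eqF// height_gt0. Qed.

Lemma klein_norm (x : H) : 1 = (\val x).1 ^+ 2 * (1 - dp (klein x) (klein x)).
Proof. by rewrite -{1}(lorentz_self x) /lorentz klein_height !dotE; ring. Qed.

Lemma klein_lt1 (x : H) : dp (klein x) (klein x) < 1.
Proof.
have := klein_norm x; have x0 : 0 < (\val x).1 ^+ 2 by rewrite exprn_gt0// height_gt0.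
by move=> E; rewrite -subr_gt0 -(pmulr_rgt0 _ x0) -E.
Qed.

Lemma lorentz_horo (p x : H) : <|\val p, \val x|> = (\val x).1 * horo p (klein x).
Proof. by rewrite /lorentz (klein_height x) /horo !dotE; ring. Qed.

Lemma lorentz_klein (x y : H) :
  <|\val x, \val y|> = (\val x).1 * (\val y).1 * (1 - dp (klein x) (klein y)).
Proof. by rewrite /lorentz (klein_height x) (klein_height y) !dotE; ring. Qed.

Lemma klein_dot_lt1 (x y : H) : 0 < 1 - dp (klein x) (klein y).
Proof.
have h : 0 < (\val x).1 * (\val y).1 by rewrite mulr_gt0// height_gt0.
by rewrite -(pmulr_rgt0 _ h) -lorentz_klein (lt_le_trans ltr01)// lorentz_ge1.
Qed.

Lemma chord_lorentz (p x y : H) : chord p (klein x) (klein y) =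
  <|\val x, \val y|> / (<|\val p, \val x|> * <|\val p, \val y|>).
Proof.
rewrite (lorentz_klein x y) (lorentz_horo p x) (lorentz_horo p y) /chord.
have := height_gt0 x; have := height_gt0 y.
have := horo_gt0 p (ltW (klein_lt1 x)); have := horo_gt0 p (ltW (klein_lt1 y)).
by move=> *; field; rewrite ?gt_eqF.
Qed.

Lemma chord_gt0 (p x y : H) : 0 < chord p (klein x) (klein y).
Proof. by rewrite chord_lorentz divr_gt0 ?mulr_gt0// (lt_le_trans ltr01)// lorentz_ge1. Qed.

Lemma expR_gprod (p x y : H) : expR (- 2 * gprod p x y) =
  expR (mdist x y) / (expR (mdist p x) * expR (mdist p y)).
Proof. by rewrite -expRD -expRN -expRD; congr expR; rewrite /gprod; lra. Qed.

Lemma chord_gprod (p x y : H) :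
  chord p (klein x) (klein y) / 4 <= expR (- 2 * gprod p x y) <=
  2 * chord p (klein x) (klein y).
Proof.
rewrite expR_gprod chord_lorentz.
have l1 (s t : H) : 0 < <|\val s, \val t|> by rewrite (lt_le_trans ltr01)// lorentz_ge1.
have a1 := l1 x y; have b1 := l1 p x; have c1 := l1 p y.
have a2 := lorentz_le_expR x y; have b2 := lorentz_le_expR p x; have c2 := lorentz_le_expR p y.
have a3 := expR_mdist_le x y; have b3 := expR_mdist_le p x; have c3 := expR_mdist_le p y.
apply/andP; split.
  rewrite -mulrA -invfM ler_pM ?(ltW a1)// ?invr_ge0 ?mulr_ge0 ?(ltW b1) ?(ltW c1)//.
  rewrite lef_pV2 ?posrE ?mulr_gt0// ?expR_gt0//.
  have -> (s t : R) : s * t * 4 = (2 * s) * (2 * t) by ring.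
  by rewrite ler_pM ?expR_ge0.
rewrite mulrA ler_pM ?expR_ge0// ?invr_ge0 ?mulr_ge0 ?expR_ge0//.
rewrite lef_pV2 ?posrE ?mulr_gt0// ?expR_gt0//.
by rewrite ler_pM// ltW.
Qed.

Lemma mdist_ln (x y : H) : mdist x y =
  ln <|\val x, \val y|> + ln (1 + Num.sqrt (1 - (<|\val x, \val y|> ^+ 2)^-1)).
Proof.
have L1 := lorentz_ge1 x y; rewrite -lnM; last 2 first.
- by rewrite posrE (lt_le_trans ltr01).
- by rewrite posrE ltr_pwDl// sqrtr_ge0.
rewrite -[LHS]/(acosh _) /acosh; congr ln.
set L := lorentz _ _ _ in L1 *.
have L0 : 0 < L by lra.
rewrite mulrDr mulr1; congr (_ + _).
rewrite -{2}(ger0_norm (ltW L0)) -sqrtr_sqr -sqrtrM ?sqr_ge0//; congr Num.sqrt.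
by field; rewrite gt_eqF.
Qed.

(** All terms are functions of the Klein coordinates, and the corrections
    tend to constants as both points go to the boundary: distances are
    asymptotic to [ln (2 <x, y>)]. *)
Lemma gprod_ln (p x y : H) : gprod p x y =
  (- ln (chord p (klein x) (klein y)) +
    (ln (1 + Num.sqrt (1 - (1 - dp (klein x) (klein x)) / horo p (klein x) ^+ 2)) +
     ln (1 + Num.sqrt (1 - (1 - dp (klein y) (klein y)) / horo p (klein y) ^+ 2)) -
     ln (1 + Num.sqrt (1 - (1 - dp (klein x) (klein x)) * (1 - dp (klein y) (klein y)) /
       (1 - dp (klein x) (klein y)) ^+ 2)))) / 2.
Proof.
have l1 (s t : H) : 0 < <|\val s, \val t|> by rewrite (lt_le_trans ltr01)// lorentz_ge1.
rewrite chord_lorentz ln_div ?posrE ?mulr_gt0// lnM ?posrE//.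
rewrite /gprod !mdist_ln.
have kE (z : H) : 1 - dp (klein z) (klein z) = ((\val z).1 ^+ 2)^-1.
  have z0 : (\val z).1 ^+ 2 != 0 by rewrite expf_eq0/= gt_eqF// height_gt0.
  by apply: (mulfI z0); rewrite divff// -klein_norm.
have hx (z : H) : (1 - dp (klein z) (klein z)) / horo p (klein z) ^+ 2 =
    (<|\val p, \val z|> ^+ 2)^-1.
  rewrite lorentz_horo kE.
  have := height_gt0 z; have := horo_gt0 p (ltW (klein_lt1 z)).
  by move=> *; field; rewrite !gt_eqF.
have hxy : (1 - dp (klein x) (klein x)) * (1 - dp (klein y) (klein y)) /
       (1 - dp (klein x) (klein y)) ^+ 2 = (<|\val x, \val y|> ^+ 2)^-1.
  rewrite lorentz_klein !kE.
  have := height_gt0 x; have := height_gt0 y; have := klein_dot_lt1 x y.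
  set c := 1 - _; clearbody c.
  by move=> *; field; rewrite !gt_eqF.
by rewrite !hx hxy; lra.
Qed.

End horospherical.

(** * The visual distance *)

Section visual_distance.
Variables (R : realType) (V : lmodType R) (dp : {dot V for idfun}).
Local Notation H := (hyperboloid dp).

Lemma boundary_unit (xi : boundary dp) : dp (\val xi) (\val xi) = 1.
Proof. by case: xi => u /= /eqP. Qed.

Lemma boundary_dot_le1 (xi zeta : boundary dp) : dp (\val xi) (\val zeta) <= 1.
Proof.
apply: le_trans (ler_norm _) (le_trans (norm_dot_le _ _ _) _).
by rewrite /norm2 !boundary_unit sqrtr1 mulr1.
Qed.

Lemma boundary_dot1 (xi zeta : boundary dp) :
  dp (\val xi) (\val zeta) = 1 -> xi = zeta.
Proof.
move=> xz; apply: val_inj; apply/eqP; rewrite -subr_eq0; apply/eqP/(@dot_eq0 _ _ dp).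
by rewrite !dotE !boundary_unit (dotC dp (\val zeta)) xz; lra.
Qed.

Let ray (xi : boundary dp) (k : R) : 0 < k < 1 ->
  exists x : H, klein x = k *: \val xi.
Proof.
move=> /andP[k0 k1]; have s0 : 0 < 1 - k ^+ 2 by rewrite expr2; nra.
pose c := (Num.sqrt (1 - k ^+ 2))^-1; have c0 : 0 < c by rewrite invr_gt0 sqrtr_gt0.
have cP : (0 < (c, (c * k) *: \val xi).1) &&
    (lorentz dp (c, (c * k) *: \val xi) (c, (c * k) *: \val xi) == 1).
  rewrite /= c0 /lorentz/= !dotE boundary_unit; apply/eqP.
  have -> : c * c - c * k * (c * k * 1) = c ^+ 2 * (1 - k ^+ 2) by ring.
  by rewrite /c exprVn sqr_sqrtr ?(ltW s0)// mulVf// gt_eqF.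
exists (exist (fun q : R * V => (0 < q.1) && (lorentz dp q q == 1)) _ cP).
rewrite /klein/= scalerA mulrA mulVf ?mul1r//.
by rewrite gt_eqF.
Qed.

Lemma boundary_nbhs_proper (xi : boundary dp) : ProperFilter (boundary_nbhs xi).
Proof.
apply: filter_from_proper; first apply: filter_from_filter.
- by exists 1; rewrite /= ltr01.
- move=> e e' /= e0 e'0; exists (Num.min e e'); first by rewrite /= lt_min e0.
  move=> x /= xe; split; apply: lt_le_trans xe _; rewrite ler_pXn2r ?nnegrE//;
    rewrite ?le_min ?(ltW e0) ?(ltW e'0)//.
  + by rewrite ge_min lexx.
  + by rewrite ge_min lexx orbT.
move=> e /= e0; pose d := Num.min e 1 / 2.
have d0 : 0 < d by rewrite divr_gt0// lt_min e0 ltr01.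
have d1 : d < 1 by rewrite ltr_pdivrMr// mul1r gt_min; apply/orP; right; lra.
have de : d < e by rewrite ltr_pdivrMr// gt_min; apply/orP; left; lra.
have [|x kx] := @ray xi (1 - d); first by apply/andP; split; lra.
exists x; rewrite /= kx scalerBl scale1r addrAC subrr add0r !dotE boundary_unit.
have : d ^+ 2 < e ^+ 2 by rewrite ltr_pXn2r// ?nnegrE ltW.
by lra.
Qed.

#[local] Existing Instance boundary_nbhs_proper.

Lemma klein_cvg (xi : boundary dp) : strong_cvg dp (boundary_nbhs xi) (@klein _ _ dp) (\val xi).
Proof.
apply/cvgr0Pnorm_lt => e e0; exists e => // x /= xe.
rewrite ger0_norm ?norm2_ge0// -(@ltr_pXn2r _ 2)// ?nnegrE ?norm2_ge0 ?(ltW e0)//.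
by rewrite norm2_sqr.
Qed.

Lemma cvg_horo (T : Type) (F : set_system T) (FF : Filter F) (p : H)
    (u : T -> V) (xi : boundary dp) : strong_cvg dp F u (\val xi) ->
  horo p (u t) @[t --> F] --> horo p (\val xi).
Proof.
move=> ux; apply: cvgB; first exact: cvg_cst.
by apply: cvg_dot => //; exact: strong_cvg_cst.
Qed.

Lemma cvg_chord (T : Type) (F : set_system T) (FF : Filter F) (p : H)
    (u v : T -> V) (xi zeta : boundary dp) :
  strong_cvg dp F u (\val xi) -> strong_cvg dp F v (\val zeta) ->
  chord p (u t) (v t) @[t --> F] --> chord p (\val xi) (\val zeta).
Proof.
move=> ux vz; apply: cvgM; first by apply: cvgB; [exact: cvg_cst|exact: cvg_dot].
apply: cvgV; last by apply: cvgM; exact: cvg_horo.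
by rewrite mulf_neq0// gt_eqF// horo_gt0// boundary_unit.
Qed.

Lemma chord_ge0 (p : H) (xi zeta : boundary dp) : 0 <= chord p (\val xi) (\val zeta).
Proof.
rewrite divr_ge0 ?subr_ge0 ?boundary_dot_le1// mulr_ge0// ltW// horo_gt0//;
  by rewrite boundary_unit.
Qed.

Let klein_fst (xi zeta : boundary dp) :
  strong_cvg dp (filter_prod (boundary_nbhs xi) (boundary_nbhs zeta))
    (fun q : H * H => klein q.1) (\val xi).
Proof.
exact: (@cvg_comp _ _ _ fst (fun x => norm2 dp (klein x - \val xi)) _ (boundary_nbhs xi) _
  cvg_fst (klein_cvg xi)).
Qed.

Let klein_snd (xi zeta : boundary dp) :
  strong_cvg dp (filter_prod (boundary_nbhs xi) (boundary_nbhs zeta))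
    (fun q : H * H => klein q.2) (\val zeta).
Proof.
exact: (@cvg_comp _ _ _ snd (fun x => norm2 dp (klein x - \val zeta)) _ (boundary_nbhs zeta) _
  cvg_snd (klein_cvg zeta)).
Qed.

Let cvg_corr (T : Type) (F : set_system T) (FF : Filter F) (a : T -> R) :
  a t @[t --> F] --> (0 : R) ->
  ln (1 + Num.sqrt (1 - a t)) @[t --> F] --> (ln 2 : R).
Proof.
move=> a0.
have h : 1 + Num.sqrt (1 - a t) @[t --> F] --> (2 : R).
  have -> : (2 : R) = 1 + Num.sqrt (1 - 0) by rewrite subr0 sqrtr1.
  apply: cvgD; first exact: cvg_cst.
  apply: continuous_cvg; first exact: sqrt_continuous.
  by apply: cvgB => //; exact: cvg_cst.
by apply: continuous_cvg h; exact: continuous_ln.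
Qed.

(** For [xi = zeta] the chord tends to [0], so the product tends to infinity;
    otherwise each term of [gprod_ln] converges. *)
Lemma boundary_gromov_productE (p : H) (xi zeta : boundary dp) :
  boundary_gromov_product p xi zeta =
  if xi == zeta then +oo%E else
    ((ln 2 - ln (chord p (\val xi) (\val zeta))) / 2)%:E.
Proof.
rewrite /boundary_gromov_product.
pose FP := filter_prod (boundary_nbhs xi) (boundary_nbhs zeta).
have cx := @klein_fst xi zeta; have cz := @klein_snd xi zeta.
have cc : chord p (klein q.1) (klein q.2) @[q --> FP] --> chord p (\val xi) (\val zeta).
  exact: cvg_chord.
apply/cvg_lim => //; case: eqVneq => [xz|xz].
  apply/cvgeyPge => A.
  have c0 : chord p (\val xi) (\val zeta) = 0.
    by rewrite /chord xz boundary_unit subrr mul0r.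
  have : \forall q \near FP, chord p (klein q.1) (klein q.2) <= expR (- 2 * A) / 2.
    by apply: (cvgr_le _ cc); rewrite c0 divr_gt0// expR_gt0.
  apply: filterS => q; rewrite lee_fin ler_pdivlMr// => h.
  have /andP[_] := chord_gprod p q.1 q.2.
  move=> /le_trans /(_ (_ : _ <= expR (- 2 * A))) h2.
  have : gprod p q.1 q.2 >= A.
    suff : expR (- 2 * gprod p q.1 q.2) <= expR (- 2 * A) by rewrite ler_expR; lra.
    by apply: h2; lra.
  exact.
have lt1 : 0 < 1 - dp (\val xi) (\val zeta).
  rewrite subr_gt0 lt_neqAle boundary_dot_le1 andbT.
  by apply: contra xz => /eqP /boundary_dot1 ->.
have hx0 : 0 < horo p (\val xi) by rewrite horo_gt0// boundary_unit.
have hz0 : 0 < horo p (\val zeta) by rewrite horo_gt0// boundary_unit.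
have cpos : 0 < chord p (\val xi) (\val zeta) by rewrite divr_gt0// mulr_gt0.
apply: cvg_EFin; first by apply: nearW.
have -> : fine \o (fun q : H * H => (gromov_product p q.1 q.2)%:E) =
    (fun q : H * H => gprod p q.1 q.2) by [].
under eq_fun do rewrite gprod_ln.
have norm_cvg (w : H * H -> V) (eta : boundary dp) : strong_cvg dp FP w (\val eta) ->
    1 - dp (w q) (w q) @[q --> FP] --> (0 : R).
  move=> hw; rewrite -(subrr 1) -{3}(boundary_unit eta).
  by apply: cvgB; [exact: cvg_cst|exact: cvg_dot].
have horo_cvg (w : H * H -> V) (eta : boundary dp) : strong_cvg dp FP w (\val eta) ->
    (1 - dp (w q) (w q)) / horo p (w q) ^+ 2 @[q --> FP] --> (0 : R).
  move=> hw; have h0 : 0 < horo p (\val eta) by rewrite horo_gt0// boundary_unit.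
  rewrite -(mul0r ((horo p (\val eta) ^+ 2)^-1)); apply: cvgM; first exact: norm_cvg hw.
  apply: cvgV; first by rewrite gt_eqF// exprn_gt0.
  rewrite expr2; under eq_fun do rewrite expr2.
  by apply: cvgM; exact: cvg_horo hw.
apply: cvgM; last exact: cvg_cst.
rewrite addrC; apply: cvgD.
  by apply: cvgN; apply: continuous_cvg cc; exact: continuous_ln.
have -> : ln 2 = ln 2 + ln 2 - ln 2 :> R by lra.
apply: cvgB; first by apply: cvgD; apply: cvg_corr; [exact: horo_cvg cx|exact: horo_cvg cz].
apply: cvg_corr.
rewrite -(mul0r (((1 - dp (\val xi) (\val zeta)) ^+ 2)^-1)); apply: cvgM.
  by rewrite -(mul0r 0); apply: cvgM; [exact: norm_cvg cx|exact: norm_cvg cz].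
apply: cvgV; first by rewrite gt_eqF// exprn_gt0.
have c1 : 1 - dp (klein q.1) (klein q.2) @[q --> FP] --> 1 - dp (\val xi) (\val zeta).
  by apply: cvgB; [exact: cvg_cst|exact: cvg_dot].
by apply: cvgM.
Qed.

Lemma visual_distE (p : H) (xi zeta : boundary dp) :
  visual_dist p xi zeta = Num.sqrt (chord p (\val xi) (\val zeta) / 2).
Proof.
rewrite /visual_dist boundary_gromov_productE; case: eqVneq => [->|xz].
  by rewrite /chord boundary_unit subrr !mul0r sqrtr0.
have lt1 : 0 < 1 - dp (\val xi) (\val zeta).
  rewrite subr_gt0 lt_neqAle boundary_dot_le1 andbT.
  by apply: contra xz => /eqP /boundary_dot1 ->.
have c0 : 0 < chord p (\val xi) (\val zeta).
  by rewrite divr_gt0// mulr_gt0// horo_gt0// boundary_unit.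
rewrite /=; set c := chord _ _ _ in c0 *.
apply: (@pexpIrn _ 2) => //; rewrite ?nnegrE ?expR_ge0 ?sqrtr_ge0//.
have c20 : 0 <= c / 2 by rewrite divr_ge0// ltW.
rewrite (sqr_sqrtr c20) expr2 -expRD.
have -> : - ((ln 2 - ln c) / 2) + - ((ln 2 - ln c) / 2) = ln c - ln 2 by lra.
by rewrite expRD expRN !lnK ?posrE.
Qed.

Lemma visual_dist_ge0 (p : H) (xi zeta : boundary dp) : 0 <= visual_dist p xi zeta.
Proof. by rewrite visual_distE sqrtr_ge0. Qed.

Lemma limit_set_seq (G : Type) (rho : G -> isom H) (p : H) (xi : boundary dp) :
  limit_set rho p xi <->
  exists g : nat -> G, strong_cvg dp \oo (fun m => klein (rho (g m) p)) (\val xi).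
Proof.
split=> [lim|[g gx] A [e e0 eA]].
  have /choice[g gP] : forall m : nat, exists g : G,
      dp (klein (rho g p) - \val xi) (klein (rho g p) - \val xi) < m.+1%:R^-1 ^+ 2.
    move=> m; have [|g gm] := lim [set x |
        dp (klein x - \val xi) (klein x - \val xi) < m.+1%:R^-1 ^+ 2].
      by exists m.+1%:R^-1; rewrite /= ?invr_gt0.
    by exists g.
  exists g; apply: (squeeze_cvgr (f := cst 0) (h := @harmonic R)).
  - apply: nearW => m; rewrite norm2_ge0/=.
    by rewrite -(@ler_pXn2r _ 2)// ?nnegrE ?norm2_ge0// norm2_sqr ltW.
  - exact: cvg_cst.
  - exact: cvg_harmonic.
have /cvgr0Pnorm_lt/(_ e e0)/filter_ex[m] := gx.
rewrite ger0_norm ?norm2_ge0// => me; exists (g m); apply: eA => /=.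
by rewrite -norm2_sqr ltr_pXn2r// ?nnegrE ?norm2_ge0 ?ltW.
Qed.

End visual_distance.

(** * Completeness of the Hilbert space *)

Definition strongly_complete (R : realType) (V : lmodType R)
    (dp : {dot V for idfun}) : Prop :=
  forall u : nat -> V,
    (forall e : R, 0 < e -> exists N, forall m l, (N <= m)%N -> (N <= l)%N ->
      norm2 dp (u m - u l) <= e) ->
    exists xi, strong_cvg dp \oo u xi.

Section ell2_complete.
Variable R : realType.
Local Notation dot := (@dot_ell2 R).
Implicit Types u v : ell2 R.

Let sq_ge0 u i : 0 <= (\val u i : R) * \val u i.
Proof. by rewrite -expr2 sqr_ge0. Qed.

Lemma ell2_partial_le u k : series (fun i => (\val u i : R) * \val u i) k <= dot u u.
Proof.
apply: nondecreasing_cvgn_le; last exact: is_cvg_dot_ell2.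
by apply: nondecreasing_series => i _ _; exact: sq_ge0.
Qed.

Lemma ell2_coord_le u i : `|\val u i : R| <= norm2 dot u.
Proof.
rewrite -(@ler_pXn2r _ 2)// ?nnegrE ?norm2_ge0// norm2_sqr real_normK ?num_real//.
apply: le_trans (ell2_partial_le u i.+1).
by rewrite /series/= big_nat_recr//= expr2 lerDr sumr_ge0// => j _; exact: sq_ge0.
Qed.

Lemma ell2_of_bounded (a : nat -> R) (C : R) :
  (forall k, series (fun i => a i * a i) k <= C) ->
  exists u : ell2 R, \val u = a.
Proof.
move=> aC.
have cv : cvgn (series (fun i => a i ^+ 2)).
  apply: nondecreasing_is_cvgn.
    by apply: nondecreasing_series => i _ _; exact: sqr_ge0.
  exists C => _ [k _ <-]; apply: le_trans (aC k).
  by rewrite /series/=; under eq_bigr do rewrite expr2.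
have sa : @square_summable R a by apply/asboolP.
by exists (exist _ a sa).
Qed.

(** Coordinates converge, and the bound on the differences passes to the limit in
    each partial sum of squares. *)
Lemma ell2_complete : strongly_complete dot.
Proof.
move=> u cau.
have coord i : cvgn (fun m => \val (u m) i : R).
  apply: cauchy_cvg; apply/cauchyP => e e0.
  have [|N hN] := cau (e / 2); first by rewrite divr_gt0.
  exists (\val (u N) i : R); exists N => // m Nm; rewrite /ball/=.
  apply: le_lt_trans (_ : e / 2 < e); last by lra.
  by apply: le_trans (hN N m (leqnn N) Nm); exact: (ell2_coord_le (u N - u m) i).
pose a i : R := lim ((fun m => \val (u m) i : R) @ \oo).
have tail e : 0 < e -> exists N, forall m, (N <= m)%N -> forall k,
    series (fun i => (\val (u m) i - a i) * (\val (u m) i - a i)) k <= e ^+ 2.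
  move=> e0; have [N hN] := cau e e0; exists N => m Nm k.
  have cv : series (fun i => (\val (u m) i - \val (u l) i) * (\val (u m) i - \val (u l) i)) k
      @[l --> \oo] --> series (fun i => (\val (u m) i - a i) * (\val (u m) i - a i)) k.
    have diff i : (\val (u m) i - \val (u l) i : R) @[l --> \oo] --> (\val (u m) i - a i : R).
      by apply: cvgB; [exact: cvg_cst|exact: coord].
    by apply: cvg_big => [|i _]; [exact: add_continuous|apply: cvgM; exact: diff].
  apply: (cvgr_to_le cv); exists N => // l Nl.
  apply: le_trans (ell2_partial_le (u m - u l) k) _.
  rewrite -norm2_sqr ler_pXn2r ?nnegrE ?norm2_ge0 ?(ltW e0)//.
  exact: hN.
have [N1 h1] := tail 1 ltr01.
have [v vE] := ell2_of_bounded (h1 N1 (leqnn _)).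
(* The difference [u N1 - a] is square summable, hence so is the limit [a]. *)
pose xi := u N1 - v.
have xiE i : \val xi i = a i :> R.
  have -> : \val xi i = \val (u N1) i - \val v i :> R by [].
  by rewrite vE; lra.
exists xi; apply/cvgr0Pnorm_le => e e0; have [N hN] := tail e e0.
exists N => // m Nm; rewrite ger0_norm ?norm2_ge0//.
rewrite -(@ler_pXn2r _ 2)// ?nnegrE ?norm2_ge0 ?(ltW e0)// norm2_sqr.
apply: limr_le; first exact: is_cvg_dot_ell2.
apply: nearW => k; apply: le_trans (hN m Nm k).
rewrite le_eqVlt; apply/orP; left; apply/eqP; apply: eq_bigr => i _.
by have -> : \val (u m - xi) i = \val (u m) i - a i :> R by rewrite -xiE.
Qed.

End ell2_complete.

(** * Hoelder correspondences and Hausdorff dimension *)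

Lemma cvg_powR (R : realType) (T : Type) (F : set_system T) (FF : Filter F)
    (x : T -> R) (l a : R) : 0 < a -> 0 <= l -> (forall t, 0 <= x t) ->
  x t @[t --> F] --> l -> x t `^ a @[t --> F] --> l `^ a.
Proof.
move=> a0 l0 x0 xl.
have [l_eq0|l_neq0] := eqVneq l 0; last first.
  have lpos : 0 < l by rewrite lt_neqAle eq_sym l_neq0.
  apply: (@continuous_cvg _ _ _ _ _ _ (fun y => y `^ a)) xl.
  apply: differentiable_continuous; apply/derivable1_diffP; apply: derivable_powR.
  by rewrite in_itv/= andbT.
rewrite l_eq0 powR0 ?gt_eqF//; apply/cvgr0Pnorm_le => e e0.
have ea0 : 0 < e `^ a^-1 by rewrite powR_gt0.
rewrite l_eq0 in xl; have xle : \forall t \near F, x t <= e `^ a^-1 by exact: (cvgr_le _ xl).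
apply: filterS xle => t xe.
rewrite ger0_norm ?powR_ge0//.
have -> : e = (e `^ a^-1) `^ a by rewrite -powRrM mulVf ?gt_eqF// powRr1// ltW.
by rewrite ge0_ler_powR ?nnegrE ?(ltW a0) ?(ltW ea0).
Qed.

Section hoelder_dimension.
Variables (R : realType) (X1 X2 : Type) (d1 : X1 -> X1 -> R) (d2 : X2 -> X2 -> R).
Variables (A1 : set X1) (A2 : set X2) (rel : X1 -> X2 -> Prop) (B a : R).
Hypothesis a_gt0 : 0 < a.
Hypothesis B_gt0 : 0 < B.
Hypothesis d2_ge0 : forall y y', 0 <= d2 y y'.
Hypothesis rel_total : forall x, A1 x -> exists2 y, A2 y & rel x y.
Hypothesis rel_hoelder : forall x x' y y', rel x y -> rel x' y' ->
  d1 x x' <= B * d2 y y' `^ a.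
Local Open Scope ereal_scope.

Lemma diameter_ge0 (X : Type) (d : X -> X -> R) U : 0 <= diameter d U.
Proof. by rewrite /diameter le_max lexx. Qed.

Lemma hausdorff_content_ge0 (X : Type) (d : X -> X -> R) s delta A :
  0 <= hausdorff_content d s delta A.
Proof.
by apply/ereal_infP => _ [U _ <-]; apply: nneseries_ge0 => i _ _; exact: poweR_ge0.
Qed.

Lemma hausdorff_measure_ge0 (X : Type) (d : X -> X -> R) s A :
  0 <= hausdorff_measure d s A.
Proof.
apply: le_trans (hausdorff_content_ge0 d s 1 A) _.
by apply: ereal_sup_ubound; exists 1%R => //=.
Qed.

Let related (U : set X2) : set X1 := [set x | exists2 y, U y & rel x y].

Lemma related_diameter U : diameter d1 (related U) <= B%:E * diameter d2 U `^ a.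
Proof.
rewrite {1}/diameter ge_max mule_ge0 ?poweR_ge0 ?lee_fin ?(ltW B_gt0)//=.
apply: ub_ereal_sup => _ [[x x'] [/= [y Uy xy] [y' Uy' xy']] <-].
apply: (@le_trans _ _ (B * d2 y y' `^ a)%R%:E).
  by rewrite lee_fin; exact: rel_hoelder.
rewrite EFinM -poweR_EFin; apply: lee_wpmul2l; first by rewrite lee_fin ltW.
apply: gt0_ler_poweR; rewrite ?(ltW a_gt0)// ?in_itv/= ?leey ?andbT ?diameter_ge0//.
  by rewrite lee_fin.
rewrite /diameter le_max; apply/orP; right.
by apply: ereal_sup_ubound; exists (y, y').
Qed.

(** A cover of [A2] by sets of diameter at most [delta'] gives a cover of [A1] by sets
    of diameter at most [delta], and [d1 ^ (s / a)] is bounded by a multiple of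
    [d2 ^ s]. *)
Lemma hoelder_hausdorff_measure s : (0 < s)%R ->
  hausdorff_measure d2 s A2 = 0 -> hausdorff_measure d1 (s / a) A1 = 0.
Proof.
move=> s0 m0; apply/eqP; rewrite eq_le hausdorff_measure_ge0 andbT.
apply: ub_ereal_sup => _ [delta /= delta0 <-].
apply/lee_addgt0Pr => e e0; rewrite add0e.
pose delta' := ((delta / B) `^ a^-1)%R.
have delta'0 : (0 < delta')%R by rewrite powR_gt0// divr_gt0.
have c0 : hausdorff_content d2 s delta' A2 = 0.
  apply/eqP; rewrite eq_le hausdorff_content_ge0 andbT -m0.
  by apply: ereal_sup_ubound; exists delta'.
pose Bs := (B `^ (s / a))%R; have Bs0 : (0 < Bs)%R by rewrite powR_gt0.
have [||_ [U [AU Ud] <-] sumU] :=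
    @lb_ereal_inf_adherent R _ (e / Bs)%R _ (_ : hausdorff_content d2 s delta' A2 \is a fin_num).
- by rewrite divr_gt0.
- by rewrite c0.
rewrite [X in _ < X + _]c0 add0e in sumU.
apply: ge_ereal_inf; exists (\sum_(0 <= i <oo) diameter d1 (related (U i)) `^ (s / a)).
  exists (fun i => related (U i)) => //; split.
    move=> x /rel_total[y A2y xy]; have [i _ Uy] := AU _ A2y.
    by exists i => //; exists y.
  move=> i; apply: le_trans (related_diameter (U i)) _.
  have : diameter d2 (U i) `^ a <= delta'%:E `^ a.
    apply: gt0_ler_poweR; rewrite ?(ltW a_gt0)// ?in_itv/= ?leey ?andbT ?diameter_ge0//.
    by rewrite lee_fin ltW.
  rewrite poweR_EFin /delta' -powRrM mulVf ?gt_eqF// powRr1 ?divr_ge0 ?(ltW delta0) ?(ltW B_gt0)//.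
  move=> h; apply: (@le_trans _ _ (B%:E * (delta / B)%R%:E)).
    by apply: lee_wpmul2l => //; rewrite lee_fin ltW.
  by rewrite -EFinM lee_fin mulrC divfK// gt_eqF.
apply: (@le_trans _ _ (\sum_(0 <= i <oo) Bs%:E * diameter d2 (U i) `^ s)).
  apply: lee_nneseries => [i _ _|i _]; first exact: poweR_ge0.
  have sa : (0 <= s / a)%R by rewrite divr_ge0 ?ltW.
  apply: (@le_trans _ _ ((B%:E * diameter d2 (U i) `^ a) `^ (s / a))).
    apply: gt0_ler_poweR; rewrite // ?in_itv/= ?leey ?andbT ?diameter_ge0//.
      by rewrite mule_ge0 ?poweR_ge0// lee_fin ltW.
    exact: related_diameter.
  rewrite poweRM ?poweR_ge0 ?lee_fin ?(ltW B_gt0)// poweR_EFin -poweRrM.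
  by rewrite (mulrC a) divfK ?gt_eqF.
rewrite nneseriesZl; last by move=> i _; exact: poweR_ge0.
apply: (@le_trans _ _ (Bs%:E * (e / Bs)%R%:E)).
  by apply: lee_wpmul2l; rewrite ?lee_fin ltW.
by rewrite -EFinM lee_fin mulrC divfK// gt_eqF.
Qed.

Lemma hoelder_hausdorff_dim : a%:E * hausdorff_dim d1 A1 <= hausdorff_dim d2 A2.
Proof.
apply/ereal_infP => _ [s [/= s0 ms] <-].
apply: (@le_trans _ _ (a%:E * (s / a)%R%:E)); last first.
  by rewrite -EFinM lee_fin mulrC divfK// gt_eqF.
apply: lee_wpmul2l; first by rewrite lee_fin ltW.
apply: ereal_inf_lbound; exists (s / a)%R => //=; split; first exact: divr_gt0.
exact: hoelder_hausdorff_measure.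
Qed.

End hoelder_dimension.

(** * Comparison of limit sets *)

Section limit_sets.
Variables (R : realType) (V : lmodType R) (dp : {dot V for idfun}).
Local Notation H := (hyperboloid dp).
Variables (G : Type) (p : H).
Implicit Types rho : G -> isom H.

Local Notation orb rho g := (klein (rho g p)).

Lemma chord_orbit_le rho1 rho2 (a C : R) : 0 < a ->
  (forall g h, a * gprod p (rho2 g p) (rho2 h p) - C <= gprod p (rho1 g p) (rho1 h p)) ->
  exists2 B, 0 < B & forall g h,
    chord p (orb rho1 g) (orb rho1 h) <= B * chord p (orb rho2 g) (orb rho2 h) `^ a.
Proof.
move=> a0 comp; exists (4 * expR (2 * C) * 2 `^ a).
  by rewrite !mulr_gt0 ?expR_gt0 ?powR_gt0//.
move=> g h; have /andP[c1 _] := chord_gprod p (rho1 g p) (rho1 h p).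
have /andP[_ c2] := chord_gprod p (rho2 g p) (rho2 h p).
have q2 := chord_gt0 p (rho2 g p) (rho2 h p).
move: c1 c2 q2 (comp g h); set Q1 := chord _ _ _; set Q2 := chord _ _ _.
set g1 := gprod _ _ _; set g2 := gprod _ _ _ => c1 c2 q2 cgh.
have e1 : expR (- 2 * g1) <= expR (2 * C) * expR (- 2 * g2) `^ a.
  by rewrite -expRM -expRD ler_expR; lra.
have e2 : expR (- 2 * g2) `^ a <= (2 * Q2) `^ a.
  have Q20 : 0 <= 2 * Q2 by rewrite pmulr_rge0// ltW.
  by rewrite ge0_ler_powR ?nnegrE ?(ltW a0) ?expR_ge0.
rewrite powRM ?(ltW q2)// in e2.
have : expR (2 * C) * expR (- 2 * g2) `^ a <= expR (2 * C) * (2 `^ a * Q2 `^ a).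
  by rewrite ler_wpM2l ?expR_ge0.
by lra.
Qed.

(** The boundary correspondence between two actions, described by sequences of group
    elements, so that estimates on orbits pass to the limit. *)
Definition corresponding_limits rho1 rho2 (xi1 xi2 : boundary dp) : Prop :=
  exists g : nat -> G,
    strong_cvg dp \oo (fun m => orb rho1 (g m)) (\val xi1) /\
    strong_cvg dp \oo (fun m => orb rho2 (g m)) (\val xi2).

(** Along a sequence that converges to a point of the limit set of [rho1], the chords
    of [rho1], hence those of [rho2], tend to [0], so the Klein
    coordinates of [rho2] form a Cauchy sequence and approach the unit sphere. *)
Lemma corresponding_limit_exists rho1 rho2 (B a : R) (xi : boundary dp) :
  strongly_complete dp -> 0 < a ->
  (forall g h,
    chord p (orb rho2 g) (orb rho2 h) <= B * chord p (orb rho1 g) (orb rho1 h) `^ a) ->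
  limit_set rho1 p xi ->
  exists2 zeta, limit_set rho2 p zeta & corresponding_limits rho1 rho2 xi zeta.
Proof.
move=> compl a0 comp /limit_set_seq[g gxi].
pose w m := orb rho2 (g m); pose u m := orb rho1 (g m).
pose FP := filter_prod \oo \oo : set_system (nat * nat).
have u1 : strong_cvg dp FP (fun q => u q.1) (\val xi).
  exact: (@cvg_comp _ _ _ fst (fun m => norm2 dp (u m - \val xi)) _ \oo _ cvg_fst gxi).
have u2 : strong_cvg dp FP (fun q => u q.2) (\val xi).
  exact: (@cvg_comp _ _ _ snd (fun m => norm2 dp (u m - \val xi)) _ \oo _ cvg_snd gxi).
have ch0 x y rho : 0 <= chord p (orb rho x) (orb rho y) by rewrite ltW// chord_gt0.
have q1 : chord p (u q.1) (u q.2) `^ a @[q --> FP] --> (0 : R).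
  rewrite -[X in _ --> X](powR0 (x := a)) ?gt_eqF//; apply: cvg_powR => //.
    by move=> q; exact: ch0.
  have -> : 0 = chord p (\val xi) (\val xi) by rewrite /chord boundary_unit subrr mul0r.
  exact: cvg_chord.
have p1 := height_gt0 p; pose P := 2 * (\val p).1.
have q2 : 1 - dp (w q.1) (w q.2) @[q --> FP] --> (0 : R).
  apply: (squeeze_cvgr (f := cst 0)
    (h := fun q => P * P * B * chord p (u q.1) (u q.2) `^ a)).
  - apply: nearW => -[m l] /=; rewrite ltW ?klein_dot_lt1//=.
    have hm := horo_bounds p (ltW (klein_lt1 (rho2 (g m) p))).
    have hl := horo_bounds p (ltW (klein_lt1 (rho2 (g l) p))).
    have hm0 := horo_gt0 p (ltW (klein_lt1 (rho2 (g m) p))).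
    have hl0 := horo_gt0 p (ltW (klein_lt1 (rho2 (g l) p))).
    have -> : 1 - dp (w m) (w l) = horo p (w m) * horo p (w l) * chord p (w m) (w l).
      by rewrite /chord; field; rewrite !gt_eqF.
    case/andP: hm => _ hm; case/andP: hl => _ hl.
    rewrite -(mulrA (P * P)); apply: ler_pM; last exact: comp.
    - by rewrite mulr_ge0// ltW.
    - exact: ch0.
    - by apply: ler_pM => //; rewrite ltW.
  - exact: cvg_cst.
  - by rewrite -[X in _ --> X](mulr0 (P * P * B)); apply: cvgM => //; exact: cvg_cst.
have small e : 0 < e -> exists N, forall m l, (N <= m)%N -> (N <= l)%N ->
    1 - dp (w m) (w l) <= e.
  move=> e0; have [[X Y]] := cvgr_le _ q2 _ e0.
  move=> [[N1 _ h1] [N2 _ h2]] XY; exists (maxn N1 N2) => m l.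
  rewrite !geq_max => /andP[m1 _] /andP[_ l2].
  by apply: (XY (m, l)); split; [exact: h1|exact: h2].
have wl1 m : dp (w m) (w m) <= 1 by rewrite ltW// klein_lt1.
have [|z wz] := compl w.
  move=> e e0; have [|N hN] := small (e ^+ 2 / 2); first by rewrite divr_gt0// exprn_gt0.
  exists N => m l Nm Nl.
  rewrite -(@ler_pXn2r _ 2)// ?nnegrE ?norm2_ge0 ?(ltW e0)// norm2_sqr.
  have -> (x y : V) : dp (x - y) (x - y) = dp x x + dp y y - 2 * dp x y.
    by rewrite !dotE (dotC dp y); ring.
  by have := hN _ _ Nm Nl; have := wl1 m; have := wl1 l; lra.
have zz : dp (w m) (w m) @[m --> \oo] --> dp z z by exact: cvg_dot.
have z1 : dp z z == 1.
  rewrite eq_le; apply/andP; split.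
    by apply: (cvgr_to_le zz); exact: nearW.
  apply/ler_addgt0Pr => e e0; rewrite -lerBlDr.
  apply: (cvgr_to_ge zz); have [N hN] := small e e0.
  by exists N => // m Nm; have := hN m m Nm Nm; rewrite lerBlDr => *; lra.
pose zeta : boundary dp := exist _ z z1.
exists zeta; last by exists g; split.
by apply/limit_set_seq; exists g.
Qed.

(** The estimate between chords of orbits passes to the limit along the two common
    sequences. *)
Lemma corresponding_limits_hoelder rho1 rho2 (B a : R) : 0 < B -> 0 < a ->
  (forall g h,
    chord p (orb rho1 g) (orb rho1 h) <= B * chord p (orb rho2 g) (orb rho2 h) `^ a) ->
  forall xi1 xi1' xi2 xi2', corresponding_limits rho1 rho2 xi1 xi2 ->
    corresponding_limits rho1 rho2 xi1' xi2' ->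
  visual_dist p xi1 xi1' <= Num.sqrt (B / 2 * 2 `^ a) * visual_dist p xi2 xi2' `^ a.
Proof.
move=> B0 a0 comp xi1 xi1' xi2 xi2' [g [g1 g2]] [h [h1 h2]].
have c1 : chord p (orb rho1 (g m)) (orb rho1 (h m)) @[m --> \oo] -->
  chord p (\val xi1) (\val xi1') by exact: cvg_chord.
have c2 : chord p (orb rho2 (g m)) (orb rho2 (h m)) @[m --> \oo] -->
  chord p (\val xi2) (\val xi2') by exact: cvg_chord.
have ch : chord p (\val xi1) (\val xi1') <= B * chord p (\val xi2) (\val xi2') `^ a.
  have c3 : B * chord p (orb rho2 (g m)) (orb rho2 (h m)) `^ a @[m --> \oo] -->
      B * chord p (\val xi2) (\val xi2') `^ a.
    apply: cvgM; first exact: cvg_cst.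
    by apply: cvg_powR => //; [exact: chord_ge0|move=> m; rewrite ltW// chord_gt0].
  by apply: (ler_cvg_to c1 c3); apply: nearW => m; exact: comp.
rewrite !visual_distE; set Q1 := chord _ _ _ in ch *; set Q2 := chord _ _ _ in ch *.
have Q20 : 0 <= Q2 by exact: chord_ge0.
have half2 : 0 <= Q2 / 2 by rewrite divr_ge0.
have BB : 0 <= B / 2 * 2 `^ a by rewrite mulr_ge0 ?powR_ge0// divr_ge0// ltW.
have -> : Num.sqrt (Q2 / 2) `^ a = Num.sqrt ((Q2 / 2) `^ a).
  apply: (@pexpIrn _ 2) => //; rewrite ?nnegrE ?powR_ge0 ?sqrtr_ge0//.
  rewrite sqr_sqrtr ?powR_ge0// expr2 -powRM ?sqrtr_ge0//.
  by rewrite -expr2 sqr_sqrtr.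
have RR : 0 <= B / 2 * 2 `^ a * (Q2 / 2) `^ a by rewrite mulr_ge0// powR_ge0.
rewrite -sqrtrM// ler_sqrt//.
have E : 2 `^ a * (Q2 / 2) `^ a = Q2 `^ a by rewrite -powRM// mulrC divfK.
have -> : B / 2 * 2 `^ a * (Q2 / 2) `^ a = B * Q2 `^ a / 2 by rewrite -E; ring.
by rewrite ler_wpM2r.
Qed.

(** Comparable Gromov products, with the same multiplicative constant [a] both
    ways: one inequality makes the correspondence total on the limit set of
    [rho1], the other makes it [a]-Hoelder. *)
Lemma limit_set_dim_le rho1 rho2 (a C : R) : strongly_complete dp -> 0 < a ->
  (forall g h,
    a * gprod p (rho2 g p) (rho2 h p) - C <= gprod p (rho1 g p) (rho1 h p) /\
    a * gprod p (rho1 g p) (rho1 h p) - C <= gprod p (rho2 g p) (rho2 h p)) ->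
  (a%:E * hausdorff_dim (visual_dist p) (limit_set rho1 p) <=
   hausdorff_dim (visual_dist p) (limit_set rho2 p))%E.
Proof.
move=> compl a0 comp.
have [B B0 hB] := @chord_orbit_le rho1 rho2 a C a0 (fun g h => (comp g h).1).
have [B' _ hB'] := @chord_orbit_le rho2 rho1 a C a0 (fun g h => (comp g h).2).
apply: (@hoelder_hausdorff_dim _ _ _ _ _ _ _ (corresponding_limits rho1 rho2)
  (Num.sqrt (B / 2 * 2 `^ a))) => //.
- by rewrite sqrtr_gt0 mulr_gt0 ?powR_gt0// divr_gt0.
- exact: visual_dist_ge0.
- by move=> xi /(corresponding_limit_exists compl a0 hB').
- exact: corresponding_limits_hoelder.
Qed.

End limit_sets.

(** * Representations induced by kernels *)

Lemma squeeze_ratio (R : realType) (T : Type) (F : set_system T) (FF : Filter F)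
    (h : T -> \bar R) (l : \bar R) : (0 <= l)%E -> (forall t, 0 <= h t)%E ->
  (forall e : R, 0 < e < 1 -> \forall t \near F,
    ((1 - e)%:E * h t <= l)%E /\ ((1 - e)%:E * l <= h t)%E) ->
  h t @[t --> F] --> l.
Proof.
move=> l0 h0 close; case: l l0 close => [l||//] l0 close.
  rewrite lee_fin in l0.
  have bnd (e : R) : 0 < e < 1 -> \forall t \near F,
      exists2 s : R, h t = s%:E & (1 - e) * l <= s /\ (1 - e) * s <= l.
    move=> e01; have e1 : 0 < 1 - e by lra.
    apply: filterS (close e e01) => t.
    case: (h t) (h0 t) => [s||//] s0.
      by rewrite -!EFinM !lee_fin => -[h1 h2]; exists s.
    by rewrite gt0_muley ?lte_fin// leye_eq => -[].
  apply/fine_cvgP; split.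
    by apply: filterS (bnd (1 / 2) _) => [t [s -> _]//|]; lra.
  apply/cvgrPdist_le => d d0.
  pose e := Num.min (1 / 2) (d / (2 * (l + 1))).
  have l1 : 0 < 2 * (l + 1) by lra.
  have e0 : 0 < e by rewrite lt_min !divr_gt0.
  have e12 : e <= 1 / 2 by rewrite ge_min lexx.
  have ed : e * (2 * (l + 1)) <= d by rewrite -ler_pdivlMr// ge_min lexx orbT.
  have e01 : 0 < e < 1 by lra.
  apply: filterS (bnd e e01) => t /= [s -> [h1 h2]] /=.
  have s2 : s <= 2 * l.
    have s0 : 0 <= s by apply: le_trans h1; rewrite mulr_ge0//; lra.
    have : e * s <= 1 / 2 * s by rewrite ler_wpM2r.
    by lra.
  have : e * s <= e * (2 * l) by rewrite ler_wpM2l// ltW.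
  by have := mulr_ge0 (ltW e0) l0; rewrite ler_norml; lra.
apply/cvgeyPge => A; have half : 0 < (1 / 2 : R) < 1 by lra.
apply: filterS (close (1 / 2) half) => t [_]; rewrite gt0_muley ?lte_fin ?leye_eq; last lra.
by move=> /eqP ->; rewrite leey.
Qed.

Lemma hausdorff_dim_ge0 (R : realType) (X : Type) (d : X -> X -> R) A :
  (0 <= hausdorff_dim d A)%E.
Proof. by apply/ereal_infP => _ [s [/= s0 _] <-]; rewrite lee_fin ltW. Qed.

Section kernel_representations.
Variables (R : realType) (G : groupType).
Local Notation Hoo := (hyperbolic_space_oo R).

(** Isometries of the target are determined by their values on the total image of
    [f], where both sides act as [f (g (h z))]. *)
Lemma equivariant_mul (X : metricType R) (f : X -> Hoo) (nu : isom X -> isom Hoo) :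
  total_set (range f) -> (forall (g : isom X) z, f (g z) = nu g (f z)) ->
  forall g h, nu (g * h)%g = (nu g * nu h)%g.
Proof.
move=> totf nuE g h; apply: (isom_eq_total totf) => _ [z _ <-].
by rewrite -nuE -[RHS]/(nu g (nu h (f z))) -!nuE.
Qed.

Lemma isomVK (X : metricType R) (g : isom X) z : (g^-1)%g (g z) = z.
Proof. by have /(congr1 (fun f : isom X => f z)) : (g^-1 * g = 1)%g by exact: mulVg. Qed.

Lemma isom_cvg_dense (T : metricType R) (F1 : T -> Hoo) (x : nat -> T)
    (K : Type) (F : set_system K) (FF : Filter F) (h : K -> isom Hoo) (g : isom Hoo) :
  continuous F1 -> total_set (range F1) -> dense (range x) ->
  (forall l, h k (F1 (x l)) @[k --> F] --> g (F1 (x l))) ->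
  forall z, h k z @[k --> F] --> g z.
Proof.
move=> cF1 tot dx hx; apply: (isom_cvg_total _ tot) => _ [y _ <-].
apply/metricType_numDomainType.cvgrPdist_le => e e0.
have e3 : 0 < e / 3 by rewrite divr_gt0.
pose U := [set t : T | mdist (F1 y) (F1 t) < e / 3].
have Uy : nbhs y U by exact: (metricType_numDomainType.cvgr_dist_lt (cF1 y) e3).
have [q [Uq [l _ E]]] := dx U^° (ex_intro _ y Uy) (@open_interior _ U).
have : U (x l) by rewrite E; exact: interior_subset Uq.
rewrite /U/= => yl.
have near_l : \forall k \near F, mdist (g (F1 (x l))) (h k (F1 (x l))) <= e / 3.
  exact: (metricType_numDomainType.cvgr_dist_le (hx l)).
apply: filterS near_l => k hk.
have := metric_triangle (g (F1 y)) (g (F1 (x l))) (h k (F1 y)).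
have := metric_triangle (g (F1 (x l))) (h k (F1 (x l))) (h k (F1 y)).
by rewrite !isom_mdist (metric_sym (F1 (x l)) (F1 y)); lra.
Qed.

End kernel_representations.

(** * Convergence of representations and of dimensions *)

Theorem proposition5p9 (R : realType) (N : nat) (Gamma : groupType)
    (S : seq Gamma) (S_gen : symmetric_generating S)
    (rho : nat -> {multiplicative Gamma -> isom (hyperbolic_space R N)})
    (r : nat -> {nonneg R})
    (r_def : forall k, (r k)%:num = min_displacement S (rho k))
    (r_div : (r k)%:num @[k --> \oo] --> +oo)
    (omega : set_system nat) (Uomega : UltraFilter omega)
    (omega_nonprincipal : forall n, ~ omega [set n])
    (o : nat -> hyperbolic_space R N)
    (o_min : forall k, displacement S (rho k) (o k) <= (r k)%:num + 1)
    (T : set (asymptotic_cone r o Uomega))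
    (T_min : minimal_subtree (@cone_action _ _ Gamma r o omega Uomega rho) T)
    (rho_oo : {multiplicative Gamma -> isom T})
    (rho_ooE : forall g (p : T),
      \val (rho_oo g p) = cone_action rho g (\val p))
    (f : R -> hyperbolic_space R N -> hyperbolic_space_oo R)
    (f_emb : forall t : R, 0 < t < 1 ->
      kernel_embedding (@cosh_pow R (hyperbolic_space R N) t) (f t))
    (nu : R -> isom (hyperbolic_space R N) -> isom (hyperbolic_space_oo R))
    (nuE : forall t : R, 0 < t < 1 ->
      forall (g : isom (hyperbolic_space R N)) z, f t (g z) = nu t g (f t z))
    (F1 : T -> hyperbolic_space_oo R)
    (F1_emb : kernel_embedding (@exp_dist R T) F1)
    (mu1 : isom T -> isom (hyperbolic_space_oo R))
    (mu1E : forall (g : isom T) p, F1 (g p) = mu1 g (F1 p))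
    (x : nat -> T) (x_inj : injective x)
    (x0 : \val (x 0%N) = cone_base r o Uomega)
    (x_dense : dense (range x))
    (Gam : nat -> set Gamma) (Gam_fin : forall l, finite_set (Gam l))
    (Gam0 : Gam 0%N = [set 1%g])
    (Gam_incr : forall l m, (l <= m)%N -> Gam l `<=` Gam m)
    (Gam_cover : \bigcup_l Gam l = setT)
    (eps : nat -> R) (eps_gt0 : forall l, 0 < eps l)
    (eps_decr : nonincreasing_seq eps)
    (eps_lim : eps l @[l --> \oo] --> 0)
    (eta : R -> set T -> R)
    (eta_stable : forall (e : R) K, 0 < e -> finite_set K ->
      stability_constant (@exp_dist R T) F1 e K (eta e K))
    (K : nat -> nat -> set (hyperbolic_space R N))
    (Rel : nat -> nat -> T -> hyperbolic_space R N -> Prop)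
    (xx : nat -> nat -> nat -> hyperbolic_space R N)
    (K_approx : forall k l,
      approximable r rho rho_oo x Gam eta l (eps l) k ->
      tree_approximation r rho rho_oo x Gam eta k l (eps l) (K k l) (Rel k l))
    (xx_Rel : forall k l,
      approximable r rho rho_oo x Gam eta l (eps l) k ->
      forall i, (i <= l)%N -> Rel k l (x i) (xx k l i))
    (ell : nat -> nat)
    (ell_max : forall k, 1 < (r k)%:num ->
      approximable r rho rho_oo x Gam eta (ell k) (eps (ell k)) k /\
      forall l, approximable r rho rho_oo x Gam eta l (eps l) k ->
        (l <= ell k)%N)
    (I : nat -> isom (hyperbolic_space_oo R))
    (I_close : forall k, 1 < (r k)%:num ->
      forall l g, (l <= ell k)%N -> Gam (ell k) g ->
      mdist (I k (f (r k)%:num^-1 (rho k g (xx k (ell k) l))))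
            (F1 (rho_oo g (x l))) <= eps (ell k))
    (J : set nat) (J_lim : ell k @[k --> within J \oo] --> \oo) :
  let Rep := fun (k : nat) (g : Gamma) =>
    (I k * nu ((r k)%:num^-1)%R (rho k g) * (I k)^-1)%g in
  let Rep_oo := fun g : Gamma => mu1 (rho_oo g) in
  (forall g z, Rep k g z @[k --> within J \oo] --> Rep_oo g z) /\
  (forall n (b : 'I_n -> Gamma), free_basis b -> schottky b Rep_oo ->
    forall p : hyperbolic_space_oo R,
      hausdorff_dim (visual_dist p) (limit_set (Rep k) p)
        @[k --> within J \oo] -->
      hausdorff_dim (visual_dist p) (limit_set Rep_oo p)).
Proof.
move=> Rep Rep_oo.
pose FJ := within J \oo : set_system nat.
have r1 : \forall k \near FJ, 1 < (r k)%:num.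
  by apply: cvg_within; move/cvgryPgt : r_div; exact.
have t01 k : 1 < (r k)%:num -> 0 < ((r k)%:num^-1 : R) < 1.
  move=> rk; have r0 : 0 < (r k)%:num by exact: lt_trans rk.
  by rewrite invr_gt0 r0 invf_lt1.
have actM k g h : rho k (g * h)%g = (rho k g * rho k h)%g by exact: gmulfM.
have oo_actM g h : rho_oo (g * h)%g = (rho_oo g * rho_oo h)%g by exact: gmulfM.
have [F1_cont _ F1_tot F1_ker] := F1_emb.
have Rep_ooM g h : Rep_oo (g * h)%g = (Rep_oo g * Rep_oo h)%g.
  by rewrite /Rep_oo oo_actM; exact: (equivariant_mul F1_tot mu1E).
have RepM k : 1 < (r k)%:num -> forall g h, Rep k (g * h)%g = (Rep k g * Rep k h)%g.
  move=> rk g h; have [_ _ tot _] := f_emb _ (t01 k rk).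
  rewrite /Rep actM (equivariant_mul tot (nuE _ (t01 k rk))).
  by rewrite !mulgA mulgVK.
(* [Rep k g] moves [I k z] to a point that [I_close] puts near [F1 (rho_oo g (x l))],
   and [I_close] at the identity puts [I k z] near [F1 (x l)]. *)
have Rep_close k g l : 1 < (r k)%:num -> (l <= ell k)%N -> Gam (ell k) g ->
    mdist (Rep_oo g (F1 (x l))) (Rep k g (F1 (x l))) <= 2 * eps (ell k).
  move=> rk lk gk; pose z := f (r k)%:num^-1 (xx k (ell k) l).
  have Gam1 : Gam (ell k) 1%g by apply: (Gam_incr _ _ (leq0n _)); rewrite Gam0.
  have close1 : mdist (I k z) (F1 (x l)) <= eps (ell k).
    by have := I_close k rk l _ lk Gam1; rewrite (action1 (actM k)) (action1 oo_actM).
  have closeg := I_close k rk l _ lk gk.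
  rewrite nuE ?t01// -[nu _ _ _]/(nu _ _ z) in closeg.
  have := metric_triangle (Rep_oo g (F1 (x l))) (Rep k g (I k z)) (Rep k g (F1 (x l))).
  rewrite (isom_mdist (Rep k g)).
  have -> : Rep k g (I k z) = I k (nu (r k)%:num^-1 (rho k g) z).
    by rewrite -[LHS]/(I k (nu _ (rho k g) ((I k)^-1%g (I k z)))) isomVK.
  have <- : F1 (rho_oo g (x l)) = Rep_oo g (F1 (x l)) by rewrite mu1E.
  by move: closeg close1; rewrite (metric_sym _ (F1 (rho_oo g (x l)))) => *; lra.
have epsJ : eps (ell k) @[k --> FJ] --> (0 : R) by exact: cvg_comp J_lim eps_lim.
have cvgRep g z : Rep k g z @[k --> FJ] --> Rep_oo g z.
  apply: (isom_cvg_dense _ F1_cont F1_tot x_dense) => l.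
  apply/metricType_numDomainType.cvgrPdist_le => e e0.
  have e2 : 0 < e / 2 by rewrite divr_gt0.
  have [m _ gm] : (\bigcup_l Gam l) g by rewrite Gam_cover.
  have big : \forall k \near FJ, (maxn l m <= ell k)%N.
    exact: (J_lim [set q | (maxn l m <= q)%N] (nbhs_infty_ge _)).
  have small : \forall k \near FJ, eps (ell k) <= e / 2 by exact: (cvgr_le _ epsJ).
  near=> k.
  have rk : 1 < (r k)%:num by near: k.
  have : (maxn l m <= ell k)%N by near: k.
  rewrite geq_max => /andP[lk mk].
  apply: le_trans (Rep_close k g l rk lk (Gam_incr _ _ mk _ gm)) _.
  have : eps (ell k) <= e / 2 by near: k.
  by lra.
split=> [//|n b basis sch p].
have r_omega : (r k)%:num @[k --> omega] --> +oo.
  by move=> A /r_div; exact: nonprincipal_cofinite.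
have treeT : gromov_hyperbolic T 0.
  move=> q u v w.
  exact: (cone_zero_hyperbolic (@hyperboloid_hyperbolic _ _ _) r_omega
    (\val q) (\val u) (\val v) (\val w)).
have [[D turnD] grow] := schottky_turns basis oo_actM Rep_ooM (fun g => mu1E (rho_oo g))
  (exp_kernel_close F1_ker) (x 0%N) p treeT sch.
apply: squeeze_ratio => [|k|e e01]; [exact: hausdorff_dim_ge0|exact: hausdorff_dim_ge0|].
have ln16 : 0 <= ln 16 / 2 :> R by rewrite divr_ge0// ln_ge0//; lra.
have nearM : \forall k \near FJ, forall g h, Rep k (g * h)%g = (Rep k g * Rep k h)%g.
  by apply: filterS r1 => k /RepM.
have [C] := orbit_gprod_stable basis _ (@hyperboloid_hyperbolic _ _ _) ln16 nearM Rep_ooM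
  (fun g => cvgRep g p) turnD grow e01.
apply: filterS => k comp.
have e10 : 0 < 1 - e by move: e01; lra.
split.
  apply: (limit_set_dim_le (@ell2_complete R) e10 (C := C)) => g h.
  by have [] := comp g h; split.
apply: (limit_set_dim_le (@ell2_complete R) e10 (C := C)) => g h.
by have [] := comp g h; split.
Unshelve. all: by end_near. Qed.
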